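(* Let $d\ge1$ be an integer, $p\ge1$, $0<s<1$, and let $\alpha,\beta\in\mathbb{R}$ satisfy $\alpha,\ \beta,\ \alpha+\beta\in(-d,sp)$, $sp-\alpha-\beta\ne d$, and $sp<d$. Put $q=\frac{dp}{d-sp}$. Then the weighted Hardy--Sobolev--Maz'ya inequality fails, i.e. there does not exist a positive constant $C_0=C_0(d,s,p,\alpha,\beta)$ such that $$\int_{\mathbb{R}^d}\int_{\mathbb{R}^d}\frac{|u(x)-u(y)|^p}{|x-y|^{d+sp}}|x|^\alpha|y|^\beta\,dy\,dx-\mathcal{C}\int_{\mathbb{R}^d}\frac{|u(x)|^p}{|x|^{sp-\alpha-\beta}}\,dx\ \ge\ C_0\left(\int_{\mathbb{R}^d}|u(x)|^q\,|x|^{\frac qp(\alpha+\beta)}\,dx\right)^{\frac pq}$$ for all $u\in W^{s,p}_{\alpha,\beta}(\mathbb{R}^d)$, where $\mathcal{C}=\mathcal{C}_1(d,s,p,\alpha,\beta)$ is the constant defined in the context (the optimal constant in the weighted fractional Hardy inequality with singularity at the origin).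
   Context: Functions are real-valued. The weighted fractional Sobolev space is $$W^{s,p}_{\alpha,\beta}(\mathbb{R}^d)=\left\{u\in L^p\left(\mathbb{R}^d,|x|^{\alpha+\beta}\right):\ [u]_{W^{s,p}_{\alpha,\beta}(\mathbb{R}^d)}<\infty\right\},\qquad [u]^p_{W^{s,p}_{\alpha,\beta}(\mathbb{R}^d)}=\int_{\mathbb{R}^d}\int_{\mathbb{R}^d}\frac{|u(x)-u(y)|^p}{|x-y|^{d+sp}}|x|^\alpha|y|^\beta\,dx\,dy,$$ where $L^p(\mathbb{R}^d,|x|^{\alpha+\beta})$ is the $L^p$ space with respect to the measure $|x|^{\alpha+\beta}dx$. For $r\in(0,1)$ define $$\Phi_{d,s,p}(r)=|\mathbb{S}^{d-2}|\int_{-1}^1\frac{(1-t^2)^{\frac{d-3}{2}}}{(1-2tr+r^2)^{\frac{d+sp}{2}}}\,dt\quad (d\ge2),\qquad \Phi_{1,s,p}(r)=(1-r)^{-1-sp}+(1+r)^{-1-sp},$$ where $|\mathbb{S}^{d-2}|$ is the surface measure of the unit sphere in $\mathbb{R}^{d-1}$ ($|\mathbb{S}^0|=2$), and $$\mathcal{C}_1(d,s,p,\alpha,\beta)=\int_0^1 r^{sp-1}\left(r^{-\alpha}+r^{-\beta}\right)\left|1-r^{(d+\alpha+\beta-sp)/p}\right|^p\Phi_{d,s,p}(r)\,dr.$$ The weighted fractional Hardy inequality referred to is $[u]^p_{W^{s,p}_{\alpha,\beta}(\mathbb{R}^d)}\ge\mathcal{C}_1\int_{\mathbb{R}^d}|u(x)|^p|x|^{\alpha+\beta-sp}\,dx$,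 for $u\in C_c(\mathbb{R}^d)$ when $sp-\alpha-\beta<d$ and for $u\in C_c(\mathbb{R}^d\setminus\{0\})$ when $sp-\alpha-\beta>d$. *)

(* Defs.v *)
From HB Require Import structures.
From mathcomp Require Import all_boot all_order all_algebra.
From mathcomp Require Import all_classical all_reals all_analysis.

Set Implicit Arguments.
Unset Strict Implicit.
Unset Printing Implicit Defensive.

Import Order.TTheory GRing.Theory Num.Theory.
Import numFieldNormedType.Exports.

Local Open Scope classical_set_scope.
Local Open Scope ring_scope.

(* R^n with its Borel sigma-algebra (the product one, generated by the
   coordinates). *)
Notation Rvec R n := (n.-tuple (measurableTypeR R)).

Section cons_measure.
Context {R : realType} {n : nat}.

Definition cons_vec (z : measurableTypeR R * Rvec R n) : Rvec R n.+1 :=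
  [tuple of z.1 :: z.2].

Lemma measurable_cons_vec : measurable_fun setT cons_vec.
Proof. exact: (measurable_cons measurable_fst measurable_snd). Qed.

Definition cons_measure (m : {sigma_finite_measure set (Rvec R n) -> \bar R}) :
    set (Rvec R n.+1) -> \bar R :=
  pushforward (lebesgue_measure \x m)%E cons_vec.

Variable m : {sigma_finite_measure set (Rvec R n) -> \bar R}.

Let cons_measure0 : cons_measure m set0 = 0%E.
Proof. by rewrite /cons_measure /pushforward preimage_set0 measure0. Qed.

Let cons_measure_ge0 A : (0 <= cons_measure m A)%E.
Proof. by rewrite /cons_measure /pushforward measure_ge0. Qed.

Let cons_measure_sigma_additive : semi_sigma_additive (cons_measure m).
Proof.
move=> F mF tF mUF; rewrite /cons_measure /pushforward preimage_bigcup.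
apply: measure_semi_sigma_additive.
- by move=> k; rewrite -[X in measurable X]setTI; exact: measurable_cons_vec.
- apply/trivIsetP => /= i j _ _ ij; rewrite -preimage_setI.
  by move/trivIsetP : tF => -> //; rewrite preimage_set0.
- rewrite -preimage_bigcup -[X in measurable X]setTI.
  exact: measurable_cons_vec.
Qed.

HB.instance Definition _ := isMeasure.Build _ _ _ (cons_measure m)
  cons_measure0 cons_measure_ge0 cons_measure_sigma_additive.

Let uncons_vec (x : Rvec R n.+1) : measurableTypeR R * Rvec R n :=
  (thead x, [tuple of behead x]).

Let measurable_uncons_vec : measurable_fun setT uncons_vec.
Proof.
by apply/measurable_fun_pairP; split;
  [exact: measurable_tnth|exact: measurable_behead].
Qed.

Let cons_measure_sigma_finite : sigma_finite setT (cons_measure m).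
Proof.
have /sigma_finiteP[F [FT ndF Foo]] := sigma_finiteT (@lebesgue_measure R).
have /sigma_finiteP[G [GT ndG Goo]] := sigma_finiteT m.
exists (fun k => uncons_vec @^-1` (F k `*` G k)).
  rewrite -preimage_bigcup -[LHS](preimage_setT uncons_vec); congr (_ @^-1` _).
  rewrite -setXTT FT GT predeqE => -[x y]; split.
    move=> [/= [i _ Fix] [j _ Gjy]]; exists (maxn i j) => //; split.
    - by move: x Fix; exact/subsetPset/ndF/leq_maxl.
    - by move: y Gjy; exact/subsetPset/ndG/leq_maxr.
  by move=> [i _ []/= ? ?]; split; exists i.
move=> k; have [mF Fkoo] := Foo k; have [mG Gkoo] := Goo k; split.
  rewrite -[X in measurable X]setTI.
  by apply: measurable_uncons_vec => //; exact: measurableX.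
rewrite /cons_measure /pushforward -comp_preimage.
rewrite (_ : uncons_vec \o cons_vec = id) ?preimage_id.
  by rewrite product_measure1E// lte_mul_pinfty// ge0_fin_numE.
apply/funext => -[a t] /=; rewrite /uncons_vec /cons_vec /= theadE.
by congr pair; exact/val_inj.
Qed.

HB.instance Definition _ := @Measure_isSigmaFinite.Build _ _ _ (cons_measure m)
  cons_measure_sigma_finite.

End cons_measure.

(* Lebesgue measure on R^n, as the n-fold product of lebesgue_measure (on the
   point R^0 it is the unit mass). *)
Fixpoint lebesgue_vec (R : realType) (n : nat) :
    {sigma_finite_measure set (Rvec R n) -> \bar R} :=
  match n with
  | 0%N => \d_([tuple] : Rvec R 0)
  | n'.+1 => cons_measure (lebesgue_vec R n')
  end.

Definition enorm (R : realType) (n : nat) (x : Rvec R n) : R :=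
  Num.sqrt (\sum_(i < n) tnth x i ^+ 2).

Definition vec_sub (R : realType) (n : nat) (x y : Rvec R n) : Rvec R n :=
  [tuple (tnth x i - tnth y i : measurableTypeR R) | i < n].

Definition vec_scale (R : realType) (n : nat) (a : R) (x : Rvec R n) :
    Rvec R n :=
  [tuple (a * tnth x i : measurableTypeR R) | i < n].

Definition unit_sphere (R : realType) (n : nat) : set (Rvec R n) :=
  [set x | enorm x = 1].

Definition cone (R : realType) (n : nat) (E : set (Rvec R n)) :
    set (Rvec R n) :=
  [set y | exists t x, [/\ 0 < t, t <= 1, E x & y = vec_scale t x]].

(* The (n-1)-dimensional surface measure of a part E of the unit sphere of R^n
   in polar coordinates; for n = 1 it is the counting measure on {-1, 1}. *)
Definition surface_measure (R : realType) (n : nat) (E : set (Rvec R n)) :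
    \bar R :=
  (n%:R%:E * lebesgue_vec R n (cone E))%E.

(* The values of powR at 0 (0 `^ a = 0 for a != 0) only matter on null sets
   in the integrals below. *)

(* Phi_{d,s,p}(r), for d >= 1 and 0 < r < 1. *)
Definition Phi (R : realType) (d : nat) (s p r : R) : \bar R :=
  if d == 1%N then
    ((1 - r) `^ (- 1 - s * p) + (1 + r) `^ (- 1 - s * p))%:E
  else
    (surface_measure (@unit_sphere R d.-1) *
     \int[lebesgue_measure]_(t in `[(- 1)%R, 1%R])
       ((1 - t ^+ 2) `^ ((d%:R - 3) / 2) /
        (1 - 2 * t * r + r ^+ 2) `^ ((d%:R + s * p) / 2))%:E)%E.

Definition hardy_const (R : realType) (d : nat) (s p alpha beta : R) : \bar R :=
  (\int[lebesgue_measure]_(r in `]0%R, 1%R[)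
     ((r `^ (s * p - 1) * (r `^ (- alpha) + r `^ (- beta)) *
       `|1 - r `^ ((d%:R + alpha + beta - s * p) / p)| `^ p)%:E
      * Phi d s p r))%E.

(* [u]^p, the p-th power of the weighted Gagliardo seminorm. *)
Definition gagliardo_pow (R : realType) (d : nat) (s p alpha beta : R)
    (u : Rvec R d -> R) : \bar R :=
  (\int[lebesgue_vec R d]_x \int[lebesgue_vec R d]_y
     (`|u x - u y| `^ p / enorm (vec_sub x y) `^ (d%:R + s * p)
      * enorm x `^ alpha * enorm y `^ beta)%:E)%E.

(* Elements are represented by Borel functions: every class modulo equality
   almost everywhere of Lebesgue measurable functions contains one. *)
Definition weighted_sobolev (R : realType) (d : nat) (s p alpha beta : R) :
    set (Rvec R d -> R) :=
  [set u : Rvec R d -> R | [/\ measurable_fun setT u,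
     (\int[lebesgue_vec R d]_x
        (`|u x| `^ p * enorm x `^ (alpha + beta))%:E < +oo)%E &
     (gagliardo_pow s p alpha beta u < +oo)%E]].

(* Main.v *)
(* The function w(x) = |x|^(-gamma), gamma = (d + alpha + beta - s p) / p, is
   the ground state of the weighted fractional Hardy inequality, and we test
   the inequality on truncations F(w) of it, where F is the tent function of
   height b - 1 supported by [1, 2 b - 1].  In polar coordinates, with
   |x| = r t, |y| = r, 0 < t < 1, the energy of a radial function becomes an
   integral of t against the weight of the Hardy constant C, of the quantity
   J(t) = \int |F(w(r t)) - F(w(r))|^p r^(p gamma - 1) dr.  If T is the
   truncation of w - 1 to [0, 2 b - 2], then |F a - F b| <= |a - b| and
   |F a - F b| <= |T a - T b|, so
   |F a - F b|^p <= |a - b|^(p - 1) |T a - T b|; as T is monotone,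
   J(t) <= |t^(-gamma) - 1|^p A / |gamma| with A = \int T(1 / v) dv over v > 0.
   Up to a common factor this bounds the energy by C A, while the Hardy term
   is C \int F(1 / v)^p v^(p - 1) dv >= C (A - p - 2).  The left-hand side
   thus stays bounded as b -> oo.  But the integral on the right-hand side is
   \int F(1 / v)^q v^(q - 1) dv >= A - q - 2 up to a constant, and A -> oo. *)

(* The energy and the Hardy term both grow like A, that is like ln b, so the leading constant of the
   energy bound must be exactly C: a bound correct up to a factor would be useless. This dictates
   the splitting of the increment. If all p factors were estimated by |a - b|, the constant C would
   appear, but multiplied by the divergent integral of dv / v; keeping one factor in T makes that
   integral finite at no cost in the constant. The tent replaces the plain truncation T because T(w)
   is a positive constant for large w: for gamma < 0 this is a constant near infinity, outside the
   weighted L^p space. F(w) vanishes for small and for large w, so one family of test functions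
   serves both signs of gamma. *)
Require Import Defs.
From HB Require Import structures.
From mathcomp Require Import all_boot all_order all_algebra.
From mathcomp Require Import all_classical all_reals all_analysis.
From mathcomp Require Import measurable_realfun ring lra.
Import Order.TTheory GRing.Theory Num.Theory.
Import numFieldNormedType.Exports.
Local Open Scope classical_set_scope.
Local Open Scope ring_scope.

Set Implicit Arguments.
Unset Strict Implicit.
Unset Printing Implicit Defensive.

(** * Measurability, Tonelli and transfer of integrals *)

Section measurability.
Context d (T : measurableType d) (R : realType).
Implicit Types (f g : T -> R) (D : set T).

Lemma measurable_fun_powR D f (a : R) :
  measurable_fun D f -> measurable_fun D (fun x => f x `^ a).
Proof. exact: (measurableT_comp (measurable_powR a)). Qed.

Lemma measurable_fun_norm D f :
  measurable_fun D f -> measurable_fun D (fun x => `|f x|).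
Proof. exact: (measurableT_comp (@normr_measurable R setT)). Qed.

Lemma measurable_fun_sqrt D f :
  measurable_fun D f -> measurable_fun D (fun x => Num.sqrt (f x)).
Proof.
apply: (@measurableT_comp _ _ _ _ _ _ (@Num.sqrt R)).
by apply: continuous_measurable_fun => x; exact: sqrt_continuous.
Qed.

Lemma measurable_fun_inv D f :
  measurable_fun D f -> measurable_fun D (fun x => (f x)^-1).
Proof.
move=> mf.
(* At 0 the conventions agree, both the inverse and the power being 0, so two cases suffice. *)
have E x : (f x)^-1 = (if 0 <= f x then (f x) `^ (-1)
                       else - (- f x) `^ (-1)).
  case: ifPn => [f0|]; first by rewrite powR_inv1.
  by rewrite -ltNge => f0; rewrite powR_inv1 ?oppr_ge0 ?ltW// invrN opprK.
rewrite (_ : (fun x => _) = (fun x => if 0 <= x then x `^ (-1)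
     else - (- x) `^ (-1)) \o f); last by apply/funext => x /=; rewrite E.
apply: measurableT_comp => //; apply: measurable_fun_ifT.
- exact: measurable_fun_ler.
- exact: measurable_powR.
- apply: measurableT_comp => //.
  exact: (measurableT_comp (measurable_powR _) (@oppr_measurable R setT)).
Qed.

Lemma measurable_fun_ln D f :
  measurable_fun D f -> measurable_fun D (fun x => ln (f x)).
Proof. exact: (measurableT_comp (@measurable_ln R)). Qed.

Lemma measurable_fun_expR D f :
  measurable_fun D f -> measurable_fun D (fun x => expR (f x)).
Proof. exact: (measurableT_comp (@measurable_expR R)). Qed.

Lemma measurable_fun_EFin D f :
  measurable_fun D f -> measurable_fun D (fun x => (f x)%:E).
Proof. by move=> mf; exact/measurable_EFinP. Qed.

Lemma measurable_fun_tnth n (f : T -> Rvec R n) i :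
  measurable_fun setT f -> measurable_fun setT (fun x => tnth (f x) i : R).
Proof. by move=> mf; exact: (measurableT_comp (measurable_tnth i)). Qed.

Lemma measurable_fun_ltEFin f (g : T -> \bar R) :
  measurable_fun setT f -> measurable_fun setT g ->
  measurable_fun setT (fun x => ((f x)%:E < g x)%E).
Proof.
move=> mf mg; apply: (measurable_fun_bool true) => //.
rewrite setTI preimage_true.
rewrite -[X in measurable X]setTI; apply: emeasurable_fun_lt => //.
exact: measurable_fun_EFin.
Qed.
End measurability.

Lemma measurable_fun_comp2 d0 d1 d2 d3 (T0 : measurableType d0)
    (T1 : measurableType d1) (T2 : measurableType d2) (T3 : measurableType d3)
    (F : T1 -> T2 -> T3) (a : T0 -> T1) (b : T0 -> T2) :
  measurable_fun setT (fun z => F z.1 z.2) ->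
  measurable_fun setT a -> measurable_fun setT b ->
  measurable_fun setT (fun x => F (a x) (b x)).
Proof.
move=> mF ma mb.
apply: (@measurableT_comp _ _ _ _ _ _ (fun z => F z.1 z.2) _ (fun x => (a x, b x))) => //.
exact: measurable_fun_pair.
Qed.

Lemma measurable_fun_fst d0 d1 d2 (T0 : measurableType d0)
    (T1 : measurableType d1) (T2 : measurableType d2) (f : T0 -> T1 * T2) :
  measurable_fun setT f -> measurable_fun setT (fun x => (f x).1).
Proof. exact: (measurableT_comp measurable_fst). Qed.

Lemma measurable_fun_snd d0 d1 d2 (T0 : measurableType d0)
    (T1 : measurableType d1) (T2 : measurableType d2) (f : T0 -> T1 * T2) :
  measurable_fun setT f -> measurable_fun setT (fun x => (f x).2).
Proof. exact: (measurableT_comp measurable_snd). Qed.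

Ltac eta_measurable :=
  lazymatch goal with
  | |- measurable_fun ?D ?f =>
      let g := eval cbv beta in (fun x => f x) in change (measurable_fun D g)
  end.

(** Descends along the expression. Functions outside its table, such as [Phi] or a composite with a
    variable function, are first put in the context as hypotheses and found by [assumption]. *)
Ltac meas_step := try eta_measurable;
  lazymatch goal with
  | |- measurable_fun _ (fun x => EFin _) => apply: measurable_fun_EFin
  | |- measurable_fun _ (fun x => powR _ _) => apply: measurable_fun_powR
  | |- measurable_fun _ (fun x => `|_|%R) => apply: measurable_fun_norm
  | |- measurable_fun _ (fun x => Num.sqrt _) => apply: measurable_fun_sqrt
  | |- measurable_fun _ (fun x => ln _) => apply: measurable_fun_ln
  | |- measurable_fun _ (fun x => expR _) => apply: measurable_fun_expR
  | |- measurable_fun _ (fun x => andb _ _) => apply: measurable_and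
  | |- measurable_fun _ (fun x => (_ < _)%O) =>
      first [apply: measurable_fun_ltr | apply: measurable_fun_ltEFin]
  | |- measurable_fun _ (fun x => (_ <= _)%O) => apply: measurable_fun_ler
  | |- measurable_fun _ (fun x => (_ ^+ _)%R) => apply: measurable_funX
  | |- measurable_fun _ (fun x => (_ * _)%E) => apply: emeasurable_funM
  | |- measurable_fun _ (fun x => (_ * _)%R) => apply: measurable_funM
  | |- measurable_fun _ (fun x => (_ - _)%R) => apply: measurable_funB
  | |- measurable_fun _ (fun x => (_ + _)%E) =>
      first [apply: measurable_funD | apply: emeasurable_funD]
  | |- measurable_fun _ (fun x => (_ + _)%R) =>
      first [apply: measurable_funD | apply: emeasurable_funD]
  | |- measurable_fun _ (fun x => (- _)%R) =>
      apply: (measurableT_comp (@oppr_measurable _ setT))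
  | |- measurable_fun _ (fun x => (_^-1)%R) => apply: measurable_fun_inv
  | |- measurable_fun _ (fun x => tnth _ _) => apply: measurable_fun_tnth
  | |- measurable_fun _ (fun x => fst x) => exact: measurable_fst
  | |- measurable_fun _ (fun x => snd x) => exact: measurable_snd
  | |- measurable_fun _ (fun x => fst _) => apply: measurable_fun_fst
  | |- measurable_fun _ (fun x => snd _) => apply: measurable_fun_snd
  | |- measurable_fun _ (fun x => x) => exact: measurable_id
  | |- _ => first [exact: measurable_cst | assumption | apply: measurable_fun_ifT]
  end.

Ltac meas := repeat meas_step.

Lemma powR_mulr (R : realType) (x a : R) : 0 < x -> x `^ a * x = x `^ (a + 1).
Proof.
by move=> x0; rewrite -{2}(powRr1 (ltW x0)) -powRD// (gt_eqF x0) implybT.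
Qed.

Lemma gt0_powRD (R : realType) (x a b : R) : 0 < x ->
  x `^ (a + b) = x `^ a * x `^ b.
Proof. by move=> x0; rewrite powRD// (gt_eqF x0) implybT. Qed.

Section tonelli_swap.
Context d1 d2 (T1 : measurableType d1) (T2 : measurableType d2) (R : realType).
Variables (m1 : {sigma_finite_measure set T1 -> \bar R})
          (m2 : {sigma_finite_measure set T2 -> \bar R}).
Variable f : T1 -> T2 -> \bar R.
Hypothesis mf : measurable_fun setT (fun z => f z.1 z.2).
Hypothesis f0 : forall x y, (0 <= f x y)%E.

Lemma tonelli_swap :
  (\int[m1]_x \int[m2]_y f x y = \int[m2]_y \int[m1]_x f x y)%E.
Proof. by apply: (@fubini_tonelli _ _ _ _ _ m1 m2 _ mf) => -[x y]; exact: f0. Qed.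

Lemma measurable_tonelli1 : measurable_fun setT (fun x => \int[m2]_y f x y)%E.
Proof.
by apply: (@measurable_fun_fubini_tonelli_F _ _ _ _ _ m2 _ mf) => -[x y]; exact: f0.
Qed.

Lemma measurable_tonelli2 : measurable_fun setT (fun y => \int[m1]_x f x y)%E.
Proof.
by apply: (@measurable_fun_fubini_tonelli_G _ _ _ _ _ m1 _ mf) => -[x y]; exact: f0.
Qed.
End tonelli_swap.

Lemma indic_if (T : Type) (R : realType) (b : T -> bool) (x : T) :
  ((\1_[set y | b y] x)%:E = if b x then 1 else 0 :> \bar R)%E.
Proof.
rewrite indicE; case: ifPn => bx; first by rewrite mem_set.
by rewrite memNset//=; exact/negP.
Qed.

Section layer_cake.
Context (R : realType).
Local Notation mu := (@lebesgue_measure R).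

Lemma layer_cake (y : \bar R) : (0 <= y)%E ->
  (\int[mu]_s (if (0 < s)%R && (s%:E < y) then 1 else 0) = y)%E.
Proof.
move=> y0.
have m0 : measurable [set s : R | (0 < s)%R && (s%:E < y)%E].
  rewrite (_ : mkset _ = `]0%R, +oo[%classic `&` [set s | s%:E < y]%E); last first.
    by apply/seteqP; split=> s /=; rewrite in_itv/= andbT; [move/andP|move=> ?;
        apply/andP].
  apply: measurableI => //.
  rewrite -[X in measurable X]setTI; apply: emeasurable_fun_lt => //.
rewrite (_ : (fun s : R => _) = (fun s => (\1_[set s : R | (0 < s)%R && (s%:E <
    y)%E] s)%:E)); last first.
  by apply/funext => s; rewrite indic_if.
rewrite integral_indic// setIT.
case: y y0 m0 => [y||//] y0 m0.
- transitivity (mu `]0%R, y[%classic).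
    by congr (mu _); apply/seteqP; split => s /=; rewrite in_itv/= lte_fin.
  rewrite lebesgue_measure_itv/= lte_fin; case: ltP => [_|]; first by rewrite sube0.
  by move=> y1; apply/eqP; rewrite eq_le y0 lee_fin y1.
- transitivity (mu `]0%R, +oo[%classic).
    by congr (mu _); apply/seteqP; split => s /=; rewrite in_itv/= ltry ?andbT.
  by rewrite lebesgue_measure_itv/= ltry sube0.
Qed.

End layer_cake.

Section transfer_with_density.
Context d d' (T : measurableType d) (S : measurableType d') (R : realType).
Variables (m : {sigma_finite_measure set T -> \bar R})
  (nu : {sigma_finite_measure set S -> \bar R}).
Variables (phi : T -> S) (g : T -> \bar R).
Hypothesis mphi : measurable_fun setT phi.
Hypothesis mg : measurable_fun setT g.
Hypothesis g0 : forall x, (0 <= g x)%E.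
Hypothesis H : forall A, measurable A ->
  (\int[m]_x ((\1_A (phi x))%:E * g x) = nu A)%E.

(* By the layer-cake formula for [f] and Tonelli, it is enough to know the
   identity on indicator functions. *)
Lemma integral_transfer_with_density (f : S -> \bar R) :
  measurable_fun setT f -> (forall y, (0 <= f y)%E) ->
  (\int[m]_x (f (phi x) * g x) = \int[nu]_y f y)%E.
Proof.
move=> mf f0.
have mA (s : R) : measurable [set y | (0 < s)%R && (s%:E < f y)%E].
  rewrite (_ : mkset _ = if (0 < s)%R then [set y | s%:E < f y]%E else set0); last first.
    by case: ifP => s0; apply/seteqP; split => y.
  case: ifP => // _.
  rewrite -[X in measurable X]setTI; apply: emeasurable_fun_lt => //.
have E y : f y = (\int[@lebesgue_measure R]_s (\1_[set y | (0 < s)%R && (s%:E < f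
    y)%E] y)%:E)%E.
  rewrite -[LHS](layer_cake (f0 y)); apply: eq_integral => s _.
  by rewrite indic_if.
have mE d0 (U : measurableType d0) (psi : U -> S) : measurable_fun setT psi ->
  measurable_fun setT (fun z : U * measurableTypeR R =>
    (\1_[set y | (0 < z.2)%R && (z.2%:E < f y)%E] (psi z.1))%:E : \bar R).
  move=> mpsi.
  under eq_fun do rewrite indic_if.
  have m1 : measurable_fun setT (fun z : U * measurableTypeR R => f (psi z.1)).
    by apply: (measurableT_comp mf); apply: measurableT_comp.
  by meas.
transitivity (\int[m]_x \int[@lebesgue_measure R]_s
   ((\1_[set y | (0 < s)%R && (s%:E < f y)%E] (phi x))%:E * g x))%E.
  apply: eq_integral => x _; rewrite {1}E ge0_integralZr//.
  - exact: (measurableT_comp (mE _ _ phi mphi) (pair1_measurable x)).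
rewrite tonelli_swap; last 2 first.
- apply: emeasurable_funM; first exact: mE.
  exact: measurableT_comp.
- by move=> x y; rewrite mule_ge0.
under eq_integral do rewrite H//.
rewrite [RHS](_ : _ = \int[nu]_y \int[@lebesgue_measure R]_s (\1_[set y | (0 < s)%R
    && (s%:E < f y)%E] y)%:E)%E; last first.
  by apply: eq_integral => y _; rewrite {1}E.
rewrite tonelli_swap; last 2 first.
- exact: (mE _ S id).
- by move=> x y.
by apply: eq_integral => s _; rewrite integral_indic// setIT.
Qed.
End transfer_with_density.

(** * One-dimensional substitutions *)

Section density_pushforward.
Context d d' (T : measurableType d) (S : measurableType d') (R : realType).
Variables (m : {measure set T -> \bar R}).
Variables (phi : T -> S) (g : T -> \bar R).
Hypothesis mphi : measurable_fun setT phi.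
Hypothesis mg : measurable_fun setT g.
Hypothesis g0 : forall x, (0 <= g x)%E.

(** The image under [phi] of the measure of density [g] with respect to [m]. The proofs are
    arguments so that the measure structure declared below can be inferred from the term. *)
Definition density_pushforward of measurable_fun setT phi & measurable_fun setT g
  & (forall x, (0 <= g x)%E) := fun A : set S => (\int[m]_(x in phi @^-1` A) g x)%E.

Local Notation nu := (density_pushforward mphi mg g0).

Let nu0 : nu set0 = 0%E.
Proof. by rewrite /density_pushforward preimage_set0 integral_set0. Qed.

Let nu_ge0 A : (0 <= nu A)%E.
Proof. by apply: integral_ge0 => x _. Qed.

Let nu_sigma_additive : semi_sigma_additive nu.
Proof.
move=> F mF tF mUF; rewrite /density_pushforward; apply: cvg_toP.
  apply: ereal_nondecreasing_is_cvgn => k n kn.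
  by apply: lee_sum_nneg_natr => // i _ _; exact: integral_ge0.
rewrite preimage_bigcup ge0_integral_bigcup//=.
- by move=> k; rewrite -[X in measurable X]setTI; exact: mphi.
- exact: measurable_funTS.
- apply/trivIsetP => /= i j _ _ ij; rewrite -preimage_setI.
  by move/trivIsetP : tF => -> //; rewrite preimage_set0.
Qed.

HB.instance Definition _ := isMeasure.Build _ _ _ nu nu0 nu_ge0 nu_sigma_additive.

Lemma density_pushforwardE A : measurable A ->
  (\int[m]_x ((\1_A (phi x))%:E * g x) = nu A)%E.
Proof.
move=> mA; rewrite /density_pushforward [RHS]integral_mkcond.
apply: eq_integral => x _; rewrite patchE indicE.
have -> : (x \in phi @^-1` A) = (phi x \in A) by apply/idP/idP; rewrite !inE.
by case: ifP => _; rewrite ?mul1e ?mul0e.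
Qed.
End density_pushforward.

Section substitutions.
Context (R : realType).
Local Notation mu := (@lebesgue_measure R).
Implicit Types f F : R -> \bar R.

(** The image of |a| dx under x |-> a x + b gives each interval ]u, v] its length, hence is Lebesgue
    measure by uniqueness. *)
Lemma integral_affine (a b : R) f : a != 0 ->
  measurable_fun setT f -> (forall y, (0 <= f y)%E) ->
  (\int[mu]_x (f (a * x + b)%R * `|a|%:E) = \int[mu]_y f y)%E.
Proof.
move=> a0 mf f0.
pose phi (x : measurableTypeR R) : measurableTypeR R := a * x + b.
have mphi : measurable_fun setT phi by rewrite /phi; meas.
apply: (@integral_transfer_with_density _ _ _ _ _ mu mu phi (cst `|a|%:E)) => //.
- by move=> x; rewrite lee_fin.
- move=> A mA.
  have mg : measurable_fun setT (cst `|a|%:E : measurableTypeR R -> \bar R) by [].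
  have g0 (x : measurableTypeR R) : (0 <= cst `|a|%:E x)%E by rewrite lee_fin.
  rewrite (density_pushforwardE mu mphi mg g0)//.
  apply/esym/lebesgue_measure_unique => // _ [[u v] _ <-]/=.
  rewrite /density_pushforward integral_cst; last first.
    by rewrite -[X in measurable X]setTI; exact: mphi.
  rewrite lebesgue_measure_itv/= lte_fin.
  (* The first case is a < 0, where the preimage of ]u, v] is closed on the left and open on the
     right; the second is a > 0. *)
  have [a_gt0|a_lt0|/eqP] := ltrgtP a 0; last by rewrite (negbTE a0).
  + transitivity (`|a|%:E * mu `[((v - b) / a)%R, ((u - b) / a)%R[%classic)%E; last first.
      congr (_ * mu _)%E; apply/seteqP; split => x; rewrite /phi/= !in_itv/=.
        rewrite ler_ndivrMr// ltr_ndivlMr// => /andP[? ?]; apply/andP; split; lra.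
      rewrite ler_ndivrMr// ltr_ndivlMr// => /andP[? ?]; apply/andP; split; lra.
    rewrite lebesgue_measure_itv/= lte_fin ltr_nM2r ?invr_lt0// ltrD2r.
    case: ifP => _; last by rewrite mule0.
    rewrite -!EFinB -EFinM ltr0_norm//; congr EFin; field.
    by rewrite lt_eqF.
  + transitivity (`|a|%:E * mu `](((u - b) / a)%R), ((v - b) / a)%R]%classic)%E;
        last first.
      congr (_ * mu _)%E; apply/seteqP; split => x; rewrite /phi/= !in_itv/=.
        rewrite ltr_pdivrMr// ler_pdivlMr// => /andP[? ?]; apply/andP; split; lra.
      rewrite ltr_pdivrMr// ler_pdivlMr// => /andP[? ?]; apply/andP; split; lra.
    rewrite lebesgue_measure_itv/= lte_fin ltr_pM2r ?invr_gt0// ltrD2r.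
    case: ifP => _; last by rewrite mule0.
    rewrite -!EFinB -EFinM gtr0_norm//; congr EFin; field.
    by rewrite gt_eqF.
Qed.

Lemma integral_translate (b : R) f :
  measurable_fun setT f -> (forall y, (0 <= f y)%E) ->
  (\int[mu]_x (f (x + b)%R) = \int[mu]_y f y)%E.
Proof.
move=> mf f0; rewrite -(@integral_affine 1 b f)//.
by apply: eq_integral => x _; rewrite normr1 mule1 mul1r.
Qed.

Lemma integral_reflect f :
  measurable_fun setT f -> (forall y, (0 <= f y)%E) ->
  (\int[mu]_x (f (- x)%R) = \int[mu]_y f y)%E.
Proof.
move=> mf f0; rewrite -(@integral_affine (-1) 0 f)//.
by apply: eq_integral => x _; rewrite normrN1 mule1 mulN1r addr0.
Qed.

Lemma integral_inv_itv (u v : R) : 0 < u -> u < v ->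
  (\int[mu]_(x in `[u, v]) (x^-1)%:E = (ln v - ln u)%:E)%E.
Proof.
move=> u0 uv.
rewrite (@continuous_FTC2 _ (fun x => x^-1) (@ln R))//.
- apply: continuous_in_subspaceT => x; rewrite inE/= in_itv/= => /andP[ux _].
  by apply: inv_continuous; rewrite gt_eqF// (lt_le_trans u0).
- split.
  + move=> x; rewrite in_itv/= => /andP[ux _].
    by apply: ex_derive; apply: is_derive1_ln; exact: lt_trans ux.
  + by apply: cvg_at_right_filter; exact: continuous_ln.
  + by apply: cvg_at_left_filter; apply: continuous_ln; exact: lt_trans uv.
- move=> x; rewrite in_itv/= => /andP[ux _].
  by rewrite derive1E; apply: derive_val; apply: is_derive1_ln; exact: lt_trans ux.
Qed.

(* Lebesgue measure is the image by [ln] of the measure [dv / v] on the positive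
   half-line: compare the two on intervals. *)
Lemma integral_ln_subst F :
  measurable_fun setT F -> (forall y, (0 <= F y)%E) ->
  (\int[mu]_v (if (0 < v)%R then F (ln v) * (v^-1)%:E else 0) = \int[mu]_t F t)%E.
Proof.
move=> mF F0.
pose g (v : measurableTypeR R) : \bar R := if 0 < v then (v^-1)%:E else 0%E.
have mg : measurable_fun setT g by rewrite /g; meas.
have g0 (v : measurableTypeR R) : (0 <= g v)%E.
  by rewrite /g; case: ifP => // v0; rewrite lee_fin invr_ge0 ltW.
have mln : measurable_fun setT (@ln R : measurableTypeR R -> measurableTypeR R) by meas.
rewrite -(@integral_transfer_with_density _ _ _ _ _ mu mu _ _ mln mg g0 _ F)//.
  by apply: eq_integral => v _; rewrite /g; case: ifP => //; rewrite mule0.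
move=> A mA; rewrite (density_pushforwardE mu mln mg g0)//.
apply/esym/lebesgue_measure_unique => // _ [[a b] _ <-]/=.
rewrite /density_pushforward lebesgue_measure_itv/= lte_fin.
rewrite [RHS]integral_mkcond.
have ab0 : a < b -> expR a < expR b by rewrite ltr_expR.
have E : ((g \_ (@ln R @^-1` `]a, b])) = ((fun x => (x^-1)%:E) \_ `]expR a, expR
    b]%classic) :> (R -> \bar R)).
  apply/funext => v; rewrite !patchE /g.
  (* For v <= 0 the default value ln v = 0 may lie in ]a, b], but [g] vanishes there. *)
  have [v0|v0] := ltP 0 v; last first.
    rewrite if_same; case: ifP => //; rewrite inE/= in_itv/= => /andP[h _].
    by have := lt_le_trans h v0; rewrite ltNge expR_ge0.
  congr (if _ then _ else _); apply/idP/idP; rewrite !inE/= !in_itv/=.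
  - by move=> /andP[? ?]; rewrite -(@lnK _ v)// ltr_expR ler_expR; apply/andP.
  - rewrite -{1 2}(@lnK _ v)// ltr_expR ler_expR//.
rewrite E -integral_mkcond.
rewrite integral_itv_obnd_cbnd; last first.
  by apply: measurable_fun_EFin; apply: measurable_fun_inv.
case: ifPn => [ab|].
  by rewrite integral_inv_itv ?expR_gt0 ?ltr_expR// !expRK.
rewrite -leNgt => ba; have [->|ab] := eqVneq a b.
  by rewrite set_itv1 integral_set1.
rewrite set_itv_ge ?integral_set0//= bnd_simp -ltNge ltr_expR.
by rewrite lt_neqAle eq_sym ab.
Qed.
End substitutions.

(** * Rotation invariance *)

Section plane_rotation.
Context (R : realType).
Local Notation mu := (@lebesgue_measure R).
Implicit Types F : R -> R -> \bar R.

Lemma plane_shear1 (a : R) F :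
  measurable_fun setT (fun z => F z.1 z.2) -> (forall x y, (0 <= F x y)%E) ->
  (\int[mu]_x \int[mu]_y F (x + a * y)%R y = \int[mu]_x \int[mu]_y F x y)%E.
Proof.
move=> mF F0.
rewrite tonelli_swap//; last first.
  by apply: (measurable_fun_comp2 mF); meas.
rewrite [RHS]tonelli_swap//; apply: eq_integral => y _.
apply: (@integral_translate _ (a * y) (F ^~ y)) => //.
exact: (measurableT_comp mF (pair2_measurable y)).
Qed.

Lemma plane_shear2 (a : R) F :
  measurable_fun setT (fun z => F z.1 z.2) -> (forall x y, (0 <= F x y)%E) ->
  (\int[mu]_x \int[mu]_y F x (y + a * x)%R = \int[mu]_x \int[mu]_y F x y)%E.
Proof.
move=> mF F0; apply: eq_integral => x _.
apply: (@integral_translate _ (a * x) (F x)) => //.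
exact: (measurableT_comp mF (pair1_measurable x)).
Qed.

(* A rotation of angle theta != pi is the composite of three shears, with
   slopes - tan (theta / 2), sin theta and - tan (theta / 2). *)
Lemma plane_rotation (c s : R) F : c ^+ 2 + s ^+ 2 = 1 -> c != -1 ->
  measurable_fun setT (fun z => F z.1 z.2) -> (forall x y, (0 <= F x y)%E) ->
  (\int[mu]_x \int[mu]_y F (c * x - s * y)%R (s * x + c * y)%R =
   \int[mu]_x \int[mu]_y F x y)%E.
Proof.
move=> cs c1 mF F0; have c10 : 1 + c != 0 by rewrite addrC -[1]opprK subr_eq0.
pose t := s / (1 + c).
have st : s * t = 1 - c.
  by rewrite /t mulrA -expr2 (_ : s ^+ 2 = (1 - c) * (1 + c)) ?mulfK//; lra.
have tc : t * (1 + c) = s by rewrite /t mulfVK.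
clearbody t.
pose F1 x y := F (x + (- t) * y) y.
pose F2 x y := F1 x (y + s * x).
have mF1 : measurable_fun setT (fun z => F1 z.1 z.2).
  by apply: (measurable_fun_comp2 mF); meas.
have mF2 : measurable_fun setT (fun z => F2 z.1 z.2).
  by apply: (measurable_fun_comp2 mF1); meas.
have := plane_shear1 (- t) mF2 (fun x y => F0 _ _).
have := plane_shear2 s mF1 (fun x y => F0 _ _).
have := plane_shear1 (- t) mF F0.
rewrite -/F1 /F2 => <- <- <-.
apply: eq_integral => x _; apply: eq_integral => y _.
rewrite /F1.
have E : y + s * (x + - t * y) = s * x + c * y.
  have -> : c = 1 - s * t by rewrite st; ring.
  by ring.
rewrite E; congr (F _ _).
rewrite -tc (_ : _ - _ = x - t * y - t * ((t * (1 + c)) * x) - t * (c * y)); first ring.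
rewrite (_ : t * (t * (1 + c) * x) = (s * t) * x); last by rewrite tc; ring.
by rewrite st; ring.
Qed.
End plane_rotation.

Section euclidean.
Context (R : realType).
Local Notation mu := (@lebesgue_measure R).

Lemma integral_cons n (f : Rvec R n.+1 -> \bar R) :
  measurable_fun setT f -> (forall x, (0 <= f x)%E) ->
  (\int[lebesgue_vec R n.+1]_x f x =
   \int[mu]_t \int[lebesgue_vec R n]_x f (cons_vec (t, x)))%E.
Proof.
move=> mf f0.
rewrite [LHS](@ge0_integral_pushforward _ _ _ _ _ cons_vec measurable_cons_vec (mu
    \x lebesgue_vec R n)%E setT f)//.
rewrite preimage_setT fubini_tonelli1//.
- by apply: measurableT_comp mf _; exact: measurable_cons_vec.
- by move=> z; exact: f0.
Qed.

(** The squared norm, unlike the norm, is additive over the coordinates, as the inductions on the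
    dimension require. *)
Definition sqnorm n (x : Rvec R n) : R := \sum_(i < n) tnth x i ^+ 2.
Definition dot n (x y : Rvec R n) : R := \sum_(i < n) tnth x i * tnth y i.

Lemma measurable_sqnorm n : measurable_fun setT (@sqnorm n).
Proof. by apply: measurable_sum => i; meas. Qed.

Lemma measurable_dot n (y : Rvec R n) : measurable_fun setT (@dot n ^~ y).
Proof. by apply: measurable_sum => i; meas. Qed.

Lemma sqnorm_ge0 n (x : Rvec R n) : 0 <= sqnorm x.
Proof. by apply: sumr_ge0 => i _; exact: sqr_ge0. Qed.

Lemma sqnorm_cons n t (x : Rvec R n) :
  sqnorm (cons_vec (t, x)) = t ^+ 2 + sqnorm x.
Proof.
rewrite /sqnorm big_ord_recl /= tnth0; congr (_ + _).
by apply: eq_bigr => i _; rewrite tnthS.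
Qed.

Lemma dot_cons n t (x : Rvec R n) (y : Rvec R n.+1) :
  dot (cons_vec (t, x)) y = t * thead y + dot x [tuple of behead y].
Proof.
rewrite /dot big_ord_recl /= tnth0 (tuple_eta y) theadE; congr (_ + _).
by apply: eq_bigr => i _; rewrite !tnthS; congr (_ * tnth _ _); exact/val_inj.
Qed.

Lemma sqnorm_eta n (y : Rvec R n.+1) :
  sqnorm y = thead y ^+ 2 + sqnorm [tuple of behead y].
Proof.
by rewrite -sqnorm_cons; congr sqnorm; rewrite [LHS]tuple_eta; exact/val_inj.
Qed.

End euclidean.

Lemma measurable_fun_sqnorm d (T : measurableType d) (R : realType) n
    (f : T -> Rvec R n) :
  measurable_fun setT f -> measurable_fun setT (fun x => sqnorm (f x)).
Proof. exact: (measurableT_comp (@measurable_sqnorm R n)). Qed.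

Lemma measurable_fun_dot d (T : measurableType d) (R : realType) n
    (f : T -> Rvec R n) y :
  measurable_fun setT f -> measurable_fun setT (fun x => dot (f x) y).
Proof. exact: (measurableT_comp (@measurable_dot R n y)). Qed.

Ltac measv := repeat (try eta_measurable;
  lazymatch goal with
  | |- measurable_fun _ (fun x => sqnorm _) => apply: measurable_fun_sqnorm
  | |- measurable_fun _ (fun x => dot _ _) => apply: measurable_fun_dot
  | |- _ => meas_step
  end).

Section sqnorm_dot.
Context (R : realType).
Local Notation mu := (@lebesgue_measure R).

(* Rotation invariance, without orthogonal matrices: by induction the last
   coordinates of [y] are gathered in one coordinate, which a plane rotation
   then merges with the first one. *)
Lemma integral_sqnorm_dot n (G : R -> R -> \bar R) (y : Rvec R n.+1) :
  measurable_fun setT (fun z => G z.1 z.2) -> (forall a b, (0 <= G a b)%E) ->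
  (\int[lebesgue_vec R n.+1]_x G (sqnorm x) (dot x y) =
   \int[mu]_t \int[lebesgue_vec R n]_x
      G (t ^+ 2 + sqnorm x)%R (t * Num.sqrt (sqnorm y))%R)%E.
Proof.
elim: n G y => [|n IH] G y mG G0.
  rewrite integral_cons; [|by apply: (measurable_fun_comp2 mG); measv|by move=> x;
      exact: G0].
  rewrite sqnorm_eta.
  have dot0 (x z : Rvec R 0) : dot x z = 0 by rewrite /dot big_ord0.
  have sqn0 (x : Rvec R 0) : sqnorm x = 0 by rewrite /sqnorm big_ord0.
  rewrite sqn0 addr0 sqrtr_sqr.
  have m (a : R) : measurable_fun setT (fun t : measurableTypeR R =>
      \int[lebesgue_vec R 0]_x G (t ^+ 2 + sqnorm x)%R (t * a)%R)%E.
    apply: (@measurable_tonelli1 _ _ _ _ _ (lebesgue_vec R 0) (fun (t :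
        measurableTypeR R) x => G (t ^+ 2 + sqnorm x) (t * a))) => //.
    by apply: (measurable_fun_comp2 mG); measv.
  (* In dimension 1 the norm of y is the absolute value of its coordinate; a negative sign is
     removed by reflecting the integration variable. *)
  have [y0|y0] := leP 0 (thead y).
    apply: eq_integral => t _; apply: eq_integral => x _.
    by rewrite sqnorm_cons dot_cons dot0 addr0 sqn0 addr0 ger0_norm.
  rewrite -[RHS]integral_reflect; last 2 first.
  - exact: m.
  - by move=> t; apply: integral_ge0 => x _; exact: G0.
  apply: eq_integral => t _; apply: eq_integral => x _.
  by rewrite sqnorm_cons dot_cons dot0 addr0 sqrrN ltr0_norm// mulrNN.
rewrite integral_cons; [|by apply: (measurable_fun_comp2 mG); measv|by move=> x;
    exact: G0].
pose y' : Rvec R n.+1 := [tuple of behead y].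
pose r' := Num.sqrt (sqnorm y'); pose y1 := thead y.
pose rho := Num.sqrt (sqnorm y).
have rho2 : rho ^+ 2 = y1 ^+ 2 + r' ^+ 2.
  by rewrite /rho /r' !sqr_sqrtr ?sqnorm_ge0// sqnorm_eta.
have r'0 : 0 <= r' by exact: sqrtr_ge0.
have rho0 : 0 <= rho by exact: sqrtr_ge0.
pose F X Y := (\int[lebesgue_vec R n]_z G (X ^+ 2 + Y ^+ 2 + sqnorm z)%R (Y * rho)%R)%E.
have mF : measurable_fun setT (fun z => F z.1 z.2).
  apply: (@measurable_tonelli1 _ _ _ _ _ (lebesgue_vec R n)
     (fun (z : measurableTypeR R * measurableTypeR R) x => G (z.1 ^+ 2 + z.2 ^+ 2 +
         sqnorm x) (z.2 * rho))) => //.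
  by apply: (measurable_fun_comp2 mG); measv.
have F0 X Y : (0 <= F X Y)%E by apply: integral_ge0 => z _.
(* The rotation carries the direction (y1, r') to the second axis: its cosine is r' / rho and its
   sine y1 / rho. The cosine is nonnegative, which excludes the angle pi; when y = 0 the identity
   serves. *)
have [c [s [cs c1 E]]] : exists c s : R, [/\ c ^+ 2 + s ^+ 2 = 1, c != -1 &
    forall x t, (s * x + c * t) * rho = x * y1 + t * r'].
  have [r0|r0] := eqVneq rho 0.
    exists 1, 0; split; first by rewrite expr1n expr0n/= addr0.
      by rewrite -subr_eq0 opprK -(natrD _ 1 1) pnatr_eq0.
    have := rho2; rewrite r0 expr0n/= => /esym/eqP.
    rewrite paddr_eq0 ?sqr_ge0// !sqrf_eq0 => /andP[/eqP -> /eqP ->] x t.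
    by rewrite !mulr0 addr0.
  exists (r' / rho), (y1 / rho); split.
  - rewrite !expr_div_n -mulrDl addrC -rho2 divff// expf_eq0//=.
  - rewrite gt_eqF// (@lt_le_trans _ _ 0)// ?ltrN10//.
    by rewrite divr_ge0.
  - by move=> x t; field.
have sqE (x t : R) : x ^+ 2 + t ^+ 2 = (c * x - s * t) ^+ 2 + (s * x + c * t) ^+ 2.
  by rewrite -[LHS]mul1r -cs; ring.
transitivity (\int[mu]_x \int[mu]_t F (c * x - s * t)%R (s * x + c * t)%R)%E.
  apply: eq_integral => x _.
  under eq_integral do rewrite sqnorm_cons dot_cons.
  rewrite (IH (fun a b => G (x ^+ 2 + a) (x * thead y + b))); last 2 first.
  - by apply: (measurable_fun_comp2 mG); meas.
  - by move=> a b; exact: G0.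
  apply: eq_integral => t _; apply: eq_integral => z _.
  rewrite E; congr (G _ _); rewrite addrA; congr (_ + _).
  exact: sqE.
(* After the swap the outer variable is the rotated coordinate that carries the scalar product, and
   the other one joins the remaining n coordinates. *)
rewrite plane_rotation// tonelli_swap//; apply: eq_integral => Y _.
rewrite integral_cons.
- apply: eq_integral => X _; apply: eq_integral => z _.
  by rewrite sqnorm_cons addrA (addrC (Y ^+ 2)).
- by apply: (measurable_fun_comp2 mG); measv.
- by move=> x; exact: G0.
Qed.

End sqnorm_dot.

(** * Polar coordinates *)

Section positive_axis.
Context (R : realType).
Local Notation mu := (@lebesgue_measure R).
Implicit Types f g : R -> \bar R.

(** The integral over the half-line, encoded by cutting off the integrand rather than the domain, so
    that Tonelli and the substitutions on the whole line apply directly. *)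
Definition ipos f : \bar R := (\int[mu]_r (if (0 < r)%R then f r else 0))%E.

Lemma eq_ipos f g : (forall r, 0 < r -> f r = g r) -> ipos f = ipos g.
Proof. by move=> fg; apply: eq_integral => r _; case: ifP => // /fg. Qed.

Lemma ipos_ge0 f : (forall r, 0 < r -> (0 <= f r)%E) -> (0 <= ipos f)%E.
Proof. by move=> f0; apply: integral_ge0 => r _; case: ifP => // /f0. Qed.

Lemma measurable_pos f : measurable_fun setT f ->
  measurable_fun setT (fun r : measurableTypeR R => if 0 < r then f r else 0%E).
Proof. by move=> mf; meas. Qed.

Lemma le_ipos f g : measurable_fun setT f -> measurable_fun setT g ->
  (forall r, 0 < r -> (0 <= f r)%E) ->
  (forall r, 0 < r -> (f r <= g r)%E) -> (ipos f <= ipos g)%E.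
Proof.
move=> mf mg f0 fg; apply: ge0_le_integral => //.
- by move=> r _; case: ifP => // /f0.
- exact: measurable_pos.
- exact: measurable_pos.
- by move=> r _; case: ifP => // /fg.
Qed.

Lemma iposD f g : measurable_fun setT f -> measurable_fun setT g ->
  (forall r, 0 < r -> (0 <= f r)%E) -> (forall r, 0 < r -> (0 <= g r)%E) ->
  ipos (fun r => f r + g r)%E = (ipos f + ipos g)%E.
Proof.
move=> mf mg f0 g0; rewrite /ipos -ge0_integralD//.
- by apply: eq_integral => r _; case: ifP => //; rewrite adde0.
- by move=> r _; case: ifP => // /f0.
- exact: measurable_pos.
- by move=> r _; case: ifP => // /g0.
- exact: measurable_pos.
Qed.

Lemma iposZl (k : \bar R) f : measurable_fun setT f -> (0 <= k)%E ->
  (forall r, 0 < r -> (0 <= f r)%E) ->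
  ipos (fun r => k * f r)%E = (k * ipos f)%E.
Proof.
move=> mf k0 f0; rewrite /ipos -ge0_integralZl//.
- by apply: eq_integral => r _; case: ifP => //; rewrite mule0.
- exact: measurable_pos.
- by move=> r _; case: ifP => // /f0.
Qed.

Lemma ipos_scale (c : R) f : 0 < c -> measurable_fun setT f ->
  (forall r, 0 < r -> (0 <= f r)%E) ->
  ipos (fun r => f (c * r)%R * c%:E)%E = ipos f.
Proof.
move=> c0 mf f0; rewrite /ipos -[RHS](@integral_affine _ c 0); last 3 first.
- by rewrite gt_eqF.
- exact: measurable_pos.
- by move=> r; case: ifP => // /f0.
apply: eq_integral => r _; rewrite addr0 pmulr_rgt0// gtr0_norm//.
by case: ifP => //; rewrite mul0e.
Qed.

Lemma ipos_exp f : measurable_fun setT f -> (forall r, 0 < r -> (0 <= f r)%E) ->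
  ipos f = (\int[mu]_t (f (expR t) * (expR t)%:E))%E.
Proof.
move=> mf f0; rewrite -[RHS]integral_ln_subst.
- apply: eq_integral => v _; case: ifP => // v0.
  by rewrite lnK// -muleA -EFinM divff ?gt_eqF// mule1.
- apply: emeasurable_funM; last by meas.
  by apply: (measurableT_comp mf); exact: measurable_expR.
- by move=> t; rewrite mule_ge0 ?f0 ?expR_gt0// lee_fin expR_ge0.
Qed.

(* In the variable [ln r], [r |-> r `^ c] is the dilation by [c]. *)
Lemma ipos_pow (c : R) f : c != 0 -> measurable_fun setT f ->
  (forall r, 0 < r -> (0 <= f r)%E) ->
  ipos (fun r => f (r `^ c)%R * (`|c| * r `^ (c - 1))%:E)%E = ipos f.
Proof.
move=> c0 mf f0; rewrite !ipos_exp//; last 2 first.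
- apply: emeasurable_funM; last by meas.
  by apply: (measurableT_comp mf); exact: measurable_powR.
- by move=> r r0; rewrite mule_ge0 ?f0 ?powR_gt0// lee_fin mulr_ge0 ?powR_ge0.
rewrite -[RHS](@integral_affine _ c 0)//; last 2 first.
- apply: emeasurable_funM; last by meas.
  by apply: (measurableT_comp mf); exact: measurable_expR.
- by move=> t; rewrite mule_ge0 ?f0 ?expR_gt0// lee_fin expR_ge0.
apply: eq_integral => t _; rewrite addr0.
have E a : expR t `^ a = expR (a * t) by rewrite /powR gt_eqF ?expR_gt0// expRK.
rewrite !E -!muleA -!EFinM; congr (_ * EFin _)%E.
rewrite mulrAC -mulrA -expRD mulrC; congr (expR _ * _); ring.
Qed.

Lemma integral_split_pos f : measurable_fun setT f -> (forall r, (0 <= f r)%E) ->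
  (\int[mu]_r f r = ipos (fun r => f r + f (- r)%R))%E.
Proof.
move=> mf f0.
have mfN : measurable_fun setT (fun r : R => f (- r)).
  by apply: (measurableT_comp mf); exact: oppr_measurable.
rewrite iposD//.
have -> : ipos (fun r => f (- r)) = (\int[mu]_r (if (r < 0)%R then f r else 0))%E.
  rewrite -[RHS]integral_reflect.
  - by apply: eq_integral => r _; rewrite oppr_lt0.
  - by meas.
  - by move=> r; case: ifP.
rewrite /ipos -ge0_integralD//; last 4 first.
- by move=> r _; case: ifP.
- exact: measurable_pos.
- by move=> r _; case: ifP.
- by meas.
have -> : (\int[mu]_r f r = \int[mu]_(r in setT `\ 0%R) f r)%E.
  rewrite integral_setD1//; [exact: measurableD|exact: (measurable_funTS mf)].
rewrite [LHS]integral_mkcond; apply: eq_integral => r _; rewrite patchE.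
have [r0|r0|->] := ltrgtP r 0.
- by rewrite mem_set ?add0e//; split => //; apply/eqP; rewrite lt_eqF.
- by rewrite mem_set ?adde0//; split => //; apply/eqP; rewrite gt_eqF.
- by rewrite memNset ?adde0// => -[_]; exact.
Qed.

Lemma ipos_itv01 f : (\int[mu]_(r in `]0%R, 1%R[) f r = ipos (fun r => if (r < 1)%R
    then f r else 0))%E.
Proof.
rewrite integral_mkcond; apply: eq_integral => r _; rewrite patchE.
rewrite (_ : (r \in _) = (0 < r) && (r < 1)).
  by case: (0 < r); case: (r < 1).
by apply/idP/idP; rewrite inE/= in_itv.
Qed.

End positive_axis.

Section plane_polar.
Context (R : realType).
Local Notation mu := (@lebesgue_measure R).

(* Substitute [v = x ^+ 2 + r ^+ 2] for [r], then [v = r ^+ 2], [x = r * t]. *)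
Lemma plane_polar (m : R) (G : R -> R -> \bar R) :
  measurable_fun setT (fun z => G z.1 z.2) -> (forall a b, (0 <= G a b)%E) ->
  (\int[mu]_x ipos (fun r => G (x ^+ 2 + r ^+ 2)%R x * (r `^ m)%:E) =
   ipos (fun r => \int[mu]_t (if (t ^+ 2 < 1)%R then
     G (r ^+ 2)%R (r * t)%R * (r `^ (m + 1) * (1 - t ^+ 2) `^ ((m - 1) / 2))%:E
     else 0)))%E.
Proof.
move=> mG G0.
have pow2 (r : R) : 0 <= r -> r `^ 2 = r ^+ 2 by move=> r0; rewrite -powR_mulrn.
have two0 : (2 : R) != 0 by rewrite pnatr_eq0.
(* With w = r^2 = v - x^2, the measure r^m dr becomes 2^-1 w^((m - 1) / 2) dw. *)
pose K v x : \bar R := (if x ^+ 2 < v then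
  (G v x * (2^-1 * (v - x ^+ 2) `^ ((m - 1) / 2))%:E)%E else 0%E).
have mK : measurable_fun setT (fun z : measurableTypeR R * measurableTypeR R => K
    z.1 z.2).
  by rewrite /K; meas.
have K0 v x : (0 <= K v x)%E.
  by rewrite /K; case: ifP => // _; rewrite mule_ge0// lee_fin mulr_ge0//
      ?powR_ge0// invr_ge0.
transitivity (\int[mu]_x \int[mu]_v K v x)%E.
  apply: eq_integral => x _.
  rewrite -[RHS](@integral_translate _ (x ^+ 2)); last 2 first.
  - exact: (measurableT_comp mK (pair2_measurable x)).
  - by move=> v; exact: K0.
  pose f w : \bar R := (G (x ^+ 2 + w)%R x * (2^-1 * w `^ ((m - 1) / 2))%:E)%E.
  transitivity (ipos f).
    rewrite -(@ipos_pow _ 2 f)//; last 2 first.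
    - rewrite /f; apply: emeasurable_funM; last by meas.
      by apply: (measurable_fun_comp2 mG); meas.
    - by move=> r r0; rewrite /f mule_ge0// lee_fin mulr_ge0// ?powR_ge0// invr_ge0.
    apply: eq_ipos => r r0; rewrite /f pow2 ?ltW// -muleA -EFinM; congr (_ * EFin _)%E.
    rewrite ger0_norm// -pow2 ?ltW// -powRrM mulrACA mulVf// mul1r.
    rewrite -powRD; last by rewrite (gt_eqF r0) implybT.
    by congr (_ `^ _); field.
  rewrite /ipos; apply: eq_integral => w _; rewrite /K ltrDr.
  by case: ifP => //; rewrite /f addrK addrC.
rewrite tonelli_swap//; last first.
  exact: (measurable_fun_comp2 mK).
transitivity (ipos (fun v => \int[mu]_x K v x)%E).
  apply: eq_integral => v _; case: ifPn => //; rewrite -leNgt => v0.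
  rewrite integral0_eq// => x _; rewrite /K ltNge (le_trans v0) ?sqr_ge0//.
transitivity (ipos (fun r => (\int[mu]_x K (r `^ 2)%R x) * (`|2| * r `^ (2 - 1))%:E)%E).
  apply/esym/(ipos_pow two0 (f := fun v => \int[mu]_x K v x)%E).
  - exact: (measurable_tonelli1 mu mK).
  - by move=> r _; apply: integral_ge0 => x _; exact: K0.
apply: eq_ipos => r r0; rewrite pow2 ?ltW//.
have mKr : measurable_fun setT (fun x : measurableTypeR R => K (r ^+ 2) x).
  exact: (measurableT_comp mK (pair1_measurable (r ^+ 2))).
rewrite -(@integral_affine _ r 0 (K (r ^+ 2)) (lt0r_neq0 r0) mKr (K0 _)).
rewrite -ge0_integralZr//; last 3 first.
- apply: emeasurable_funM; last by meas.
  by apply: (measurableT_comp mKr); meas.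
- by move=> t _; rewrite mule_ge0// ?K0// lee_fin.
- by rewrite lee_fin mulr_ge0 ?powR_ge0.
apply: eq_integral => t _; rewrite addr0 /K exprMn.
rewrite (_ : (r ^+ 2 * t ^+ 2 < r ^+ 2) = (t ^+ 2 < 1)); last first.
  by rewrite -[ltRHS]mulr1 ltr_pM2l// exprn_gt0.
case: ifP => t1; last by rewrite !mul0e.
rewrite -!muleA -!EFinM; congr (_ * EFin _)%E.
rewrite (_ : r ^+ 2 - r ^+ 2 * t ^+ 2 = r ^+ 2 * (1 - t ^+ 2)); last by ring.
rewrite powRM ?sqr_ge0 ?subr_ge0 ?ltW// !gtr0_norm//.
rewrite (_ : 2 - 1 = 1); last by lra.
rewrite (powRr1 (ltW r0)) -(pow2 r (ltW r0)) -powRrM.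
rewrite (_ : 2 * ((m - 1) / 2) = m - 1); last by field.
rewrite (_ : r `^ (m + 1) = r `^ (m - 1) * r * r); first by field.
rewrite !powR_mulr//.
by congr (_ `^ _); ring.
Qed.
End plane_polar.

Section radial.
Context (R : realType).
Local Notation mu := (@lebesgue_measure R).

(** One coordinate is split off, and [plane_polar] is applied to it and the radius of the others.
    The constant starts at 2, for the two half-lines, and is multiplied by a beta integral at each
    dimension; it is identified with the surface measure only afterwards. *)
Lemma integral_sqnorm_exists n : exists c : \bar R, (0 <= c)%E /\
  forall f : R -> \bar R, measurable_fun setT f -> (forall r, (0 <= f r)%E) ->
  (\int[lebesgue_vec R n.+1]_x f (sqnorm x) =
   c * ipos (fun r => f (r ^+ 2)%R * (r `^ n%:R)%:E))%E.
Proof.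
elim: n => [|n [c [c0 IH]]].
  exists 2%:E; split; first by rewrite lee_fin.
  move=> f mf f0.
  rewrite integral_cons//; last first.
    by apply: (measurableT_comp mf); exact: measurable_sqnorm.
  have mf2 : measurable_fun setT (fun r : measurableTypeR R => f (r ^+ 2)).
    by apply: (measurableT_comp mf); meas.
  transitivity (\int[mu]_t f (t ^+ 2)%R)%E.
    apply: eq_integral => t _.
    rewrite integral_dirac//; last first.
      apply: (measurableT_comp mf); apply: (measurableT_comp (@measurable_sqnorm R 1)).
      by apply: (measurableT_comp measurable_cons_vec); exact: pair1_measurable.
    by rewrite diracT mul1e sqnorm_cons /sqnorm big_ord0 addr0.
  rewrite integral_split_pos// -iposZl//.
  - apply: eq_ipos => r r0; rewrite powRr0 mule1 sqrrN.
    by rewrite (mule_natl _ 2) mule2n.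
  - by meas.
  - by move=> r r0; rewrite mule_ge0// lee_fin powR_ge0.
pose B := (\int[mu]_t (if (t ^+ 2 < 1)%R then ((1 - t ^+ 2) `^ ((n%:R - 1) / 2))%:E
    else 0))%E.
have mB : measurable_fun setT (fun t : measurableTypeR R => if t ^+ 2 < 1 then ((1
    - t ^+ 2) `^ ((n%:R - 1) / 2))%:E else 0%E) by meas.
exists (c * B)%E; split.
  rewrite mule_ge0//; apply: integral_ge0 => t _; case: ifP => // _.
  by rewrite lee_fin powR_ge0.
move=> f mf f0.
rewrite integral_cons//; last first.
  by apply: (measurableT_comp mf); exact: measurable_sqnorm.
have mf2 : measurable_fun setT (fun r : measurableTypeR R => f (r ^+ 2)).
  by apply: (measurableT_comp mf); meas.
under eq_integral => t _.
  under eq_integral do rewrite sqnorm_cons.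
  rewrite (IH (fun a => f (t ^+ 2 + a))%R)//; last by apply: (measurableT_comp mf); meas.
  over.
rewrite ge0_integralZl//; last 2 first.
- apply: (@measurable_tonelli1 _ _ _ _ _ mu (fun t r : measurableTypeR R => if (0 <
      r)%R then (f (t ^+ 2 + r ^+ 2)%R * (r `^ n%:R)%:E)%E else 0%E)).
    apply: measurable_fun_ifT; [by meas| |by meas].
    apply: emeasurable_funM; last by meas.
    by apply: (measurableT_comp mf); meas.
  by move=> t r; case: ifP => // _; rewrite mule_ge0// lee_fin powR_ge0.
- by move=> t _; apply: ipos_ge0 => r r0; rewrite mule_ge0// lee_fin powR_ge0.
rewrite (@plane_polar _ n%:R (fun a _ => f a))//; last first.
  by apply: (measurableT_comp mf); meas.
rewrite -muleA -[in RHS]iposZl//; last 3 first.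
- by meas.
- apply: integral_ge0 => t _; case: ifP => // _; by rewrite lee_fin powR_ge0.
- by move=> r r0; rewrite mule_ge0// lee_fin powR_ge0.
congr (_ * _)%E; apply: eq_ipos => r r0.
rewrite muleC -ge0_integralZl//; last 2 first.
- by move=> t _; case: ifP => // _; rewrite lee_fin powR_ge0.
- by rewrite mule_ge0// lee_fin powR_ge0.
apply: eq_integral => t _; case: ifP => _; last by rewrite mule0.
by rewrite natr1 EFinM muleA.
Qed.

End radial.

Section sphere.
Context (R : realType).
Local Notation mu := (@lebesgue_measure R).
Local Notation S n := (surface_measure (@unit_sphere R n)).

Lemma enormE n (x : Rvec R n) : enorm x = Num.sqrt (sqnorm x).
Proof. by []. Qed.

Lemma enorm_ge0 n (x : Rvec R n) : 0 <= enorm x.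
Proof. exact: sqrtr_ge0. Qed.

Lemma enorm_sqr n (x : Rvec R n) : enorm x ^+ 2 = sqnorm x.
Proof. by rewrite enormE sqr_sqrtr// sqnorm_ge0. Qed.

Lemma measurable_enorm n : measurable_fun setT (@enorm R n).
Proof. by apply: measurable_fun_sqrt; exact: measurable_sqnorm. Qed.

Lemma sqnorm_scale n (a : R) (x : Rvec R n) :
  sqnorm (vec_scale a x) = a ^+ 2 * sqnorm x.
Proof.
rewrite /sqnorm mulr_sumr; apply: eq_bigr => i _.
by rewrite tnth_mktuple exprMn.
Qed.

Lemma cone_unit_sphere n :
  cone (@unit_sphere R n) = [set x | 0 < sqnorm x <= 1].
Proof.
apply/seteqP; split => [y [t [x [t0 t1 x1 ->]]]|y /= /andP[y0 y1]].
  rewrite /= sqnorm_scale -enorm_sqr x1 expr1n mulr1 exprn_gt0//=.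
  by rewrite expr_le1// ltW.
have e0 : 0 < enorm y by rewrite sqrtr_gt0.
exists (enorm y), (vec_scale (enorm y)^-1 y); split => //.
- by rewrite enormE -sqrtr1 ler_sqrt.
- rewrite /unit_sphere/= enormE sqnorm_scale -enorm_sqr -exprMn mulVf ?gt_eqF//.
  by rewrite expr1n sqrtr1.
- apply: eq_from_tnth => i; rewrite !tnth_mktuple mulrA mulfV ?mul1r//.
  by rewrite gt_eqF.
Qed.

Lemma ipos_le_cst (b : R) : 0 < b ->
  ipos (fun w : R => if (w <= b)%R then 1 else 0)%E = b%:E.
Proof.
move=> b0; rewrite /ipos.
transitivity (\int[mu]_w (\1_(`]0%R, b]%classic) w)%:E)%E.
  apply: eq_integral => w _; rewrite indicE.
  rewrite (_ : (w \in _) = (0 < w) && (w <= b)); first by case: (0 < w); case: (w <= b).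
  by apply/idP/idP; rewrite inE/= in_itv.
rewrite integral_indic// setIT; transitivity (mu `]0%R, b]%classic) => //.
by rewrite lebesgue_measure_itv/= lte_fin b0 sube0.
Qed.

Lemma ler_powR2 (a x y : R) : 0 < a -> 0 < x -> 0 < y ->
  (x `^ a <= y `^ a) = (x <= y).
Proof.
move=> a0 x0 y0; have [xy|yx] := leP x y.
  by apply: ge0_ler_powR; rewrite ?nnegrE ?(ltW a0) ?(ltW x0) ?(ltW y0).
by apply/negbTE; rewrite -ltNge; apply: gt0_ltr_powR; rewrite ?nnegrE ?(ltW x0) ?(ltW y0).
Qed.

(** The substitution w = r^a reduces this to the length of ]0, b^a]. *)
Lemma ipos_le_powR (a b : R) : 0 < a -> 0 < b ->
  ipos (fun r : R => if (r <= b)%R then (r `^ (a - 1))%:E else 0%E) =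
  (a^-1 * b `^ a)%:E.
Proof.
move=> a0 b0.
have ba0 : 0 < b `^ a by rewrite powR_gt0.
pose f (w : R) : \bar R := ((a^-1)%:E * (if (w <= b `^ a)%R then 1 else 0))%E.
have -> : ipos (fun r : R => if (r <= b)%R then (r `^ (a - 1))%:E else 0%E)
  = ipos f.
  rewrite -(@ipos_pow _ a f)//; first last.
  - by move=> r r0; rewrite /f; apply: mule_ge0; [by rewrite lee_fin invr_ge0
        ltW|by case: ifP].
  - by rewrite /f; meas.
  - by rewrite gt_eqF.
  apply: eq_ipos => r r0; rewrite /f ler_powR2//; case: ifP => _.
    by rewrite mule1 -EFinM gtr0_norm// mulKf// gt_eqF.
  by rewrite mule0 mul0e.
rewrite /f iposZl//.
- by rewrite ipos_le_cst.
- by meas.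
- by rewrite lee_fin invr_ge0 ltW.
- by move=> r r0; case: ifP.
Qed.

(* The constant of [integral_sqnorm_exists] is found by taking for [f] the
   indicator function of ]0, 1]. *)
Lemma integral_sqnorm n (f : R -> \bar R) :
  measurable_fun setT f -> (forall r, (0 <= f r)%E) ->
  (\int[lebesgue_vec R n.+1]_x f (sqnorm x) =
   S n.+1 * ipos (fun r => f (r ^+ 2)%R * (r `^ n%:R)%:E))%E.
Proof.
move=> mf f0.
have [c [c0 H]] := integral_sqnorm_exists R n.
rewrite H//; congr (_ * _)%E.
rewrite /surface_measure cone_unit_sphere.
pose g (v : R) : \bar R := if (0 < v) && (v <= 1) then 1%E else 0%E.
have mg : measurable_fun setT g by rewrite /g; meas.
have mset : measurable [set x : Rvec R n.+1 | 0 < sqnorm x <= 1].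
  rewrite (_ : mkset _ = setT `&` (@sqnorm R n.+1) @^-1` `]0, 1]%classic).
    exact: measurable_sqnorm.
  by apply/seteqP; split => x /=; rewrite in_itv//= => -[].
have -> : lebesgue_vec R n.+1 [set x | 0 < sqnorm x <= 1] =
          (\int[lebesgue_vec R n.+1]_x g (sqnorm x))%E.
  rewrite -[X in lebesgue_vec R n.+1 X]setIT -integral_indic//.
  by apply: eq_integral => x _; rewrite indic_if.
rewrite H//; last by move=> v; rewrite /g; case: ifP.
(* The integral of r^n over ]0, 1] cancels the factor n + 1 in [surface_measure]. *)
have -> : ipos (fun r => g (r ^+ 2)%R * (r `^ n%:R)%:E)%E = (n.+1%:R^-1)%:E.
  rewrite -[X in _ = X%:E]mulr1 -[X in _ * X](congr1 (fun h => h n.+1%:R) (powR1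
      R)) -ipos_le_powR//.
  apply: eq_ipos => r r0; rewrite /g exprn_gt0//= expr_le1 ?(ltW r0)//.
  by case: ifP => _; [rewrite mul1e -[n.+1%:R]natr1 addrK|rewrite mul0e].
by rewrite muleCA -EFinM divff ?mule1// pnatr_eq0.
Qed.

Lemma integral_enorm n (f : R -> \bar R) :
  measurable_fun setT f -> (forall r, (0 <= f r)%E) ->
  (\int[lebesgue_vec R n.+1]_x f (enorm x) =
   S n.+1 * ipos (fun r => f r * (r `^ n%:R)%:E))%E.
Proof.
move=> mf f0.
rewrite (@integral_sqnorm n (f \o Num.sqrt))//.
  congr (_ * _)%E; apply: eq_ipos => r r0 /=.
  by rewrite sqrtr_sqr gtr0_norm.
- by apply: (measurableT_comp mf); meas.
- by move=> r; exact: f0.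
Qed.

(** By induction: the unit ball lies in the product of [-1, 1] and the unit ball of the remaining
    coordinates. *)
Lemma ball_lt_pinfty n : (\int[lebesgue_vec R n]_x (if (sqnorm x <= 1)%R then 1
    else 0) < +oo)%E.
Proof.
elim: n => [|n IH].
  rewrite integral_dirac//; last by apply: measurable_fun_ifT; measv.
  by rewrite diracT mul1e; case: ifP => _; rewrite ltry.
rewrite integral_cons//; last 2 first.
- by apply: measurable_fun_ifT; measv.
- by move=> x; case: ifP.
set I := (\int[lebesgue_vec R n]_x _)%E in IH.
have I0 : (0 <= I)%E by apply: integral_ge0 => x _; case: ifP.
have mI : measurable_fun setT (fun t : measurableTypeR R => I * (\1_(`[(-1)%R,
    1%R]%classic) t)%:E)%E.
  by apply: emeasurable_funM => //; apply: measurable_fun_EFin; exact: measurable_indic.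
apply: (@le_lt_trans _ _ (\int[mu]_t (I * (\1_(`[(-1)%R, 1%R]%classic) t)%:E))%E).
  apply: ge0_le_integral => //.
  - by move=> t _; apply: integral_ge0 => x _; case: ifP.
  - apply: (@measurable_tonelli1 _ _ _ _ _ (lebesgue_vec R n)
      (fun (t : measurableTypeR R) x => if (sqnorm (cons_vec (t, x)) <= 1)%R then
          1%E else 0%E)).
      by under eq_fun do rewrite sqnorm_cons; measv.
    by move=> x y; case: ifP.
  - move=> t _; rewrite indicE.
    have [t1|t1] := leP (t ^+ 2) 1.
      rewrite mem_set ?mule1; last first.
        by rewrite /= in_itv/= -ler_norml -(@ler_pXn2r _ 2) ?nnegrE// expr1n
            real_normK ?num_real.
      apply: ge0_le_integral => //.
      - by move=> x _; case: ifP.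
      - by under eq_fun do rewrite sqnorm_cons; measv.
      - by measv.
      - move=> x _; rewrite sqnorm_cons; case: ifP => //.
          by move=> h; rewrite (le_trans _ h) ?lerDr ?sqr_ge0.
        by move=> _; case: ifP.
    rewrite integral0_eq ?mule_ge0// => x _.
    by rewrite sqnorm_cons leNgt (lt_le_trans t1) ?lerDl ?sqnorm_ge0.
rewrite ge0_integralZl//; last first.
  by apply: measurable_fun_EFin; exact: measurable_indic.
rewrite lte_mul_pinfty// ?ge0_fin_numE// integral_indic// setIT.
apply: (@le_lt_trans _ _ (mu `[(-1)%R, 1%R]%classic)) => //.
by rewrite lebesgue_measure_itv/=; case: ifP; rewrite ?ltry.
Qed.

(** The unit ball has volume S / (n + 1), so an infinite S would contradict [ball_lt_pinfty]. *)
Lemma sphere_lt_pinfty n : (S n.+1 < +oo)%E.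
Proof.
have m : measurable_fun setT (fun x : Rvec R n.+1 => if (sqnorm x <= 1)%R then 1%E
    else (0%E : \bar R)).
  by measv.
have := ball_lt_pinfty n.+1.
pose f (v : R) : \bar R := if (v <= 1)%R then 1%E else 0%E.
rewrite (@integral_sqnorm n f)//; last 2 first.
- by rewrite /f; meas.
- by move=> r; rewrite /f; case: ifP.
have -> : ipos (fun r => f (r ^+ 2)%R * (r `^ n%:R)%:E)%E = (n.+1%:R^-1)%:E.
  rewrite -[X in _ = X%:E]mulr1 -[X in _ * X](congr1 (fun h => h n.+1%:R) (powR1
      R)) -ipos_le_powR//.
  apply: eq_ipos => r r0; rewrite /f expr_le1 ?(ltW r0)//.
  by case: ifP => _; [rewrite mul1e -[n.+1%:R]natr1 addrK|rewrite mul0e].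
case: (S n.+1) => //=; first by move=> r _; rewrite ltry.
by rewrite mulyr gtr0_sg ?mul1e ?invr_gt0.
Qed.

(** If S were 0, the radial formula for the constant function 1 would give the whole space measure
    0. *)
Lemma sphere_gt0 n : (0 < S n.+1)%E.
Proof.
have S0 : (0 <= S n.+1)%E by rewrite mule_ge0.
rewrite lt_def S0 andbT; apply/negP => /eqP E.
have : (0 < \int[lebesgue_vec R n.+1]_x 1)%E.
  elim: n.+1 => [|k IH].
    by rewrite integral_dirac// diracT mul1e.
  rewrite integral_cons//.
  have mT : mu setT = +oo%E by rewrite -set_itvNyy lebesgue_measure_itv.
  apply: lt_le_trans (_ : +oo <= _)%E; first by [].
  rewrite [leRHS](integral_cst mu measurableT (\int[lebesgue_vec R k]_x 1)%E).
  by rewrite -[X in (_ * X)%E]/(mu setT) mT gt0_muley.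
by rewrite (@integral_sqnorm n (fun=> 1%E))// E mul0e ltxx.
Qed.

End sphere.

(** * Spherical average of the kernel *)

Section kernel_average.
Context (R : realType).
Local Notation mu := (@lebesgue_measure R).
Local Notation S n := (surface_measure (@unit_sphere R n)).

Lemma sqnorm_sub n (x y : Rvec R n) :
  sqnorm (vec_sub x y) = sqnorm x - 2 * dot x y + sqnorm y.
Proof.
rewrite /sqnorm /dot mulr_sumr -sumrB -big_split/=; apply: eq_bigr => i _.
by rewrite tnth_mktuple; ring.
Qed.

Lemma sqrt_powR (a k : R) : 0 <= a -> Num.sqrt a `^ k = a `^ (k / 2).
Proof. by move=> a0; rewrite -powR12_sqrt// -powRrM mulrC. Qed.

Lemma enorm_powR n (x : Rvec R n) (k : R) : enorm x `^ k = sqnorm x `^ (k / 2).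
Proof. by rewrite enormE sqrt_powR// sqnorm_ge0. Qed.

Lemma sqr_powR (a k : R) : 0 <= a -> (a ^+ 2) `^ (k / 2) = a `^ k.
Proof.
move=> a0; rewrite -powR_mulrn// -powRrM; congr (_ `^ _).
by rewrite mulrCA divff ?mulr1// pnatr_eq0.
Qed.

Lemma ltr_sqr2 (a b : R) : 0 <= a -> 0 <= b -> (a ^+ 2 < b ^+ 2) = (a < b).
Proof. by move=> a0 b0; rewrite ltr_pXn2r. Qed.

Lemma sqr_lt1 (t : R) : (t ^+ 2 < 1) = (-1 < t < 1).
Proof. by rewrite -ltr_norml -[RHS]ltr_sqr2// expr1n real_normK ?num_real. Qed.

(** The shape in which [plane_polar] delivers the angular integral: the endpoints -1 and 1, a null
    set, are dropped. *)
Lemma PhiSS n (s p r : R) : Phi n.+2 s p r =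
  (S n.+1 * \int[mu]_t (if (t ^+ 2 < 1)%R then
    ((1 - t ^+ 2) `^ ((n%:R - 1) / 2) *
     (1 - 2 * t * r + r ^+ 2) `^ (- (n.+2%:R + s * p) / 2))%:E else 0))%E.
Proof.
rewrite /Phi/=; congr (_ * _)%E.
rewrite integral_itv_bndoo; last first.
  by apply: measurable_fun_EFin; apply: measurable_funTS; meas.
rewrite integral_mkcond; apply: eq_integral => t _.
rewrite patchE (_ : (t \in _) = (t ^+ 2 < 1)); last first.
  by rewrite sqr_lt1; apply/idP/idP; rewrite inE/= in_itv.
case: ifP => // _; congr (EFin (_ `^ _ * _)).
  by rewrite -addn2 natrD; congr (_ / _); ring.
by rewrite mulNr powRN.
Qed.

Lemma Phi_ge0 d (s p r : R) : (0 <= Phi d.+1 s p r)%E.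
Proof.
case: d => [|d].
  by rewrite /Phi/= lee_fin addr_ge0// powR_ge0.
rewrite PhiSS mule_ge0//; first by rewrite mule_ge0.
apply: integral_ge0 => t _; case: ifP => // _.
by rewrite lee_fin mulr_ge0// powR_ge0.
Qed.

Lemma measurable_Phi d (s p : R) : measurable_fun setT (@Phi R d.+1 s p).
Proof.
case: d => [|d].
  by rewrite /Phi/=; meas.
rewrite (funext (PhiSS d s p)); apply: emeasurable_funM; first by [].
apply: (@measurable_tonelli1 _ _ _ _ _ mu (fun r t : measurableTypeR R =>
  if t ^+ 2 < 1 then ((1 - t ^+ 2) `^ ((d%:R - 1) / 2) *
     (1 - 2 * t * r + r ^+ 2) `^ (- (d.+2%:R + s * p) / 2))%:E else 0%E)).
  by meas.
by move=> r t; case: ifP => // _; rewrite lee_fin mulr_ge0// powR_ge0.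
Qed.

(* Rotating [y] to an axis and using polar coordinates in the orthogonal
   hyperplane, then in the plane of the axis and the radius, produces [Phi]. *)
Lemma integral_kernel n (s p : R) (f : R -> \bar R) (y : Rvec R n.+1) :
  0 < enorm y -> measurable_fun setT f -> (forall r, (0 <= f r)%E) ->
  (\int[lebesgue_vec R n.+1]_x (if (enorm x < enorm y)%R then
     f (enorm x) * (enorm (vec_sub x y) `^ (- (n.+1%:R + s * p)))%:E else 0) =
   (enorm y `^ (- (s * p)))%:E * ipos (fun r => if (r < 1)%R then
     f (enorm y * r)%R * (r `^ n%:R)%:E * Phi n.+1 s p r else 0))%E.
Proof.
move=> y0 mf f0; set rho := enorm y in y0 *; set k := n.+1%:R + s * p.
(* Since |x - y|^2 = |x|^2 - 2 x.y + |y|^2, the integrand depends on x only through a = |x|^2 and b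
   = x.y. *)
pose G a b : \bar R := (if (a < rho ^+ 2)%R then
  f (Num.sqrt a) * ((a - 2 * b + rho ^+ 2) `^ (- k / 2))%:E else 0)%E.
have mfs : measurable_fun setT (fun z : measurableTypeR R * measurableTypeR R => f
    (Num.sqrt z.1)).
  by apply: (measurableT_comp mf); meas.
have mG : measurable_fun setT (fun z : measurableTypeR R * measurableTypeR R => G
    z.1 z.2).
  by rewrite /G; meas.
have G0 a b : (0 <= G a b)%E.
  by rewrite /G; case: ifP => // _; rewrite mule_ge0// lee_fin powR_ge0.
transitivity (\int[lebesgue_vec R n.+1]_x G (sqnorm x) (dot x y))%E.
  apply: eq_integral => x _; rewrite /G -!enorm_sqr ltr_sqr2 ?enorm_ge0//.
  case: ifP => // _; rewrite sqrtr_sqr ger0_norm ?enorm_ge0//.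
  by rewrite enorm_powR sqnorm_sub -!enorm_sqr.
rewrite integral_sqnorm_dot// -enormE -/rho.
have fpos (r : R) : 0 < r -> (0 <= (if (r < 1)%R then
     f (rho * r)%R * (r `^ n%:R)%:E * Phi n.+1 s p r else 0))%E.
  move=> r0; case: ifP => // _.
  by rewrite !mule_ge0 ?Phi_ge0// lee_fin powR_ge0.
have mfr : measurable_fun setT (fun r : measurableTypeR R => f (rho * r)).
  by apply: (measurableT_comp mf); meas.
rewrite -iposZl//; last 2 first.
- have := @measurable_Phi n s p => mP; meas.
- by rewrite lee_fin powR_ge0.
(* On the line the two signs of x give the two terms of [Phi]. In higher dimension the hyperplane
   orthogonal to y is nontrivial and contributes the sphere factor. *)
case: n => [|n] in y rho y0 k G mG G0 mfs fpos mfr *.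
  pose F t := G (t ^+ 2) (t * rho).
  have mF : measurable_fun setT (F : measurableTypeR R -> \bar R).
    by apply: (measurable_fun_comp2 mG); meas.
  have F0 t : (0 <= F t)%E by exact: G0.
  transitivity (\int[mu]_t F t)%E.
    apply: eq_integral => t _; rewrite integral_dirac//; last first.
      by apply: (measurable_fun_comp2 mG); measv.
    by rewrite diracT mul1e /sqnorm big_ord0 addr0.
  have mFN : measurable_fun setT (fun t : measurableTypeR R => F (- t)).
    by apply: (measurableT_comp mF); meas.
  rewrite integral_split_pos// -(ipos_scale y0); last 2 first.
  - by meas.
  - by move=> r _; rewrite adde_ge0.
  apply: eq_ipos => r r0; rewrite /F /G sqrrN.
  rewrite (_ : ((rho * r) ^+ 2 < rho ^+ 2) = (r < 1)); last first.
    by rewrite exprMn -[ltRHS]mulr1 ltr_pM2l ?exprn_gt0// expr_lt1// ltW.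
  case: ifPn => r1; last by rewrite adde0 mul0e mule0.
  rewrite sqrtr_sqr gtr0_norm ?mulr_gt0//.
  rewrite (_ : _ - _ + _ = (rho * (1 - r)) ^+ 2); last by ring.
  rewrite (_ : (_ * _) ^+ 2 - _ + _ = (rho * (1 + r)) ^+ 2); last by ring.
  have h1 : 0 <= 1 - r by rewrite subr_ge0 ltW.
  have h2 : 0 <= 1 + r by rewrite addr_ge0 ?ltW.
  rewrite !sqr_powR ?mulr_ge0 ?(ltW y0)// !powRM ?(ltW y0)//.
  rewrite -ge0_muleDr ?lee_fin ?mulr_ge0 ?powR_ge0// /Phi/= powRr0 mule1.
  rewrite muleCA -!muleA -EFinD -!EFinM; congr (_ * EFin _)%E.
  rewrite -mulrDr mulrAC powR_mulr// /k.
  rewrite (_ : - (1 + s * p) + 1 = - (s * p)); last by ring.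
  by rewrite (_ : - (1 + s * p) = - 1 - s * p); last by ring.
under eq_integral => t _.
  rewrite (@integral_sqnorm _ n (fun a => G (t ^+ 2 + a) (t * rho)))//; last first.
    by apply: (measurable_fun_comp2 mG); meas.
  over.
have S0 : (0 <= S n.+1)%E by rewrite mule_ge0.
rewrite ge0_integralZl//; last 2 first.
- apply: (@measurable_tonelli1 _ _ _ _ _ mu (fun t r : measurableTypeR R =>
    if (0 < r)%R then (G (t ^+ 2 + r ^+ 2)%R (t * rho)%R * (r `^ n%:R)%:E)%E else 0%E)).
    apply: measurable_fun_ifT; [by meas| |by meas].
    apply: emeasurable_funM; last by meas.
    by apply: (measurable_fun_comp2 mG); meas.
  by move=> t r; case: ifP => // _; rewrite mule_ge0// lee_fin powR_ge0.
- by move=> t _; apply: ipos_ge0 => r r0; rewrite mule_ge0// lee_fin powR_ge0.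
rewrite (@plane_polar _ n%:R (fun a x => G a (x * rho)))//; last first.
  by apply: (measurable_fun_comp2 mG); meas.
pose J r := (\int[mu]_t (if (t ^+ 2 < 1)%R then G (r ^+ 2)%R (r * t * rho)%R *
   (r `^ (n%:R + 1) * (1 - t ^+ 2) `^ ((n%:R - 1) / 2))%:E else 0))%E.
have mJ : measurable_fun setT (J : measurableTypeR R -> \bar R).
  apply: (@measurable_tonelli1 _ _ _ _ _ mu (fun r t : measurableTypeR R =>
    if (t ^+ 2 < 1)%R then (G (r ^+ 2)%R (r * t * rho)%R *
    (r `^ (n%:R + 1) * (1 - t ^+ 2) `^ ((n%:R - 1) / 2))%:E)%E else 0%E)).
    apply: measurable_fun_ifT; [by meas| |by meas].
    apply: emeasurable_funM; last by meas.
    by apply: (measurable_fun_comp2 mG); meas.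
  by move=> t r; case: ifP => // _; rewrite mule_ge0// lee_fin mulr_ge0// powR_ge0.
have J0 r : (0 <= J r)%E.
  apply: integral_ge0 => t _; case: ifP => // _.
  by rewrite mule_ge0// lee_fin mulr_ge0// powR_ge0.
rewrite -/J -(ipos_scale y0 mJ (fun r _ => J0 r)) -iposZl//; last 2 first.
- apply: emeasurable_funM; last by meas.
  by apply: (measurableT_comp mJ); meas.
- by move=> r r0; rewrite mule_ge0// lee_fin ltW.
apply: eq_ipos => r r0; rewrite /J /G.
have -> : ((rho * r) ^+ 2 < rho ^+ 2) = (r < 1).
  by rewrite exprMn -[ltRHS]mulr1 ltr_pM2l ?exprn_gt0// expr_lt1// ltW.
case: ifPn => r1; last first.
  rewrite integral0_eq ?mul0e ?mule0// => t _.
  by rewrite mul0e if_same.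
rewrite PhiSS sqrtr_sqr gtr0_norm ?mulr_gt0//.
pose I := (\int[mu]_t (if (t ^+ 2 < 1)%R then
    ((1 - t ^+ 2) `^ ((n%:R - 1) / 2) *
     (1 - 2 * t * r + r ^+ 2) `^ (- (n.+2%:R + s * p) / 2))%:E else 0))%E.
rewrite -/I.
have -> : (\int[mu]_t (if (t ^+ 2 < 1)%R then f (rho * r)%R *
  (((rho * r) ^+ 2 - 2 * (rho * r * t * rho) + rho ^+ 2) `^ (- k / 2))%:E *
  ((rho * r) `^ (n%:R + 1) * (1 - t ^+ 2) `^ ((n%:R - 1) / 2))%:E else 0) =
  f (rho * r)%R * (rho `^ (- k) * (rho * r) `^ (n%:R + 1))%:E * I)%E.
  rewrite -ge0_integralZl//; last 3 first.
  - by meas.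
  - move=> t _; case: ifP => // _; by rewrite lee_fin mulr_ge0// powR_ge0.
  - by rewrite mule_ge0// lee_fin mulr_ge0// powR_ge0.
  apply: eq_integral => t _; case: ifP => t1; last by rewrite mule0.
  rewrite -!muleA -!EFinM; congr (_ * EFin _)%E.
  rewrite (_ : _ - _ + _ = rho ^+ 2 * (1 - 2 * t * r + r ^+ 2)); last by ring.
  rewrite powRM ?sqr_ge0//; last by have := sqr_ge0 (r - t); nra.
  rewrite sqr_powR ?(ltW y0)// -/k; ring.
have E1 (a b c e u : \bar R) : (a * (b * c * e * u) = a * (b * e) * (c * u))%E.
  by rewrite -!muleA; congr (_ * (_ * _))%E; rewrite muleCA.
have E2 (a b c e u : \bar R) : (a * (b * c * (e * u)) = e * (b * u) * (a * c))%E.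
  rewrite [(b * c * _)%E]muleC !muleA; congr (_ * _)%E.
  by rewrite -!muleA muleC -!muleA; congr (_ * _)%E; rewrite muleCA.
rewrite E1 E2 -!EFinM; congr (_ * EFin _)%E.
rewrite powRM ?(ltW y0) ?(ltW r0)// natr1 mulrA mulrAC; congr (_ * _).
rewrite -gt0_powRD// powR_mulr//; congr (_ `^ _).
by rewrite /k -[n.+2%:R]natr1; ring.
Qed.
End kernel_average.

(** * Energy of radial functions *)

Section ipos_swap.
Context (R : realType).
Local Notation mu := (@lebesgue_measure R).
Variable f : R -> R -> \bar R.
Hypothesis mf : measurable_fun setT (fun z : measurableTypeR R * measurableTypeR R
    => f z.1 z.2).
Hypothesis f0 : forall x y, 0 < x -> 0 < y -> (0 <= f x y)%E.

Let g (x y : measurableTypeR R) : \bar R := if 0 < x then (if 0 < y then f x y else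
    0%E) else 0%E.

Let mg : measurable_fun setT (fun z : measurableTypeR R * measurableTypeR R => g z.1 z.2).
Proof. by rewrite /g; meas. Qed.

Let g0 x y : (0 <= g x y)%E.
Proof. by rewrite /g; case: ifP => // x0; case: ifP => // y0; rewrite f0. Qed.

Lemma ipos_swap : ipos (fun x => ipos (f x)) = ipos (fun y => ipos (f ^~ y)).
Proof.
transitivity (\int[mu]_x \int[mu]_y g x y)%E.
  apply: eq_integral => x _; rewrite /g; case: ifP => // _.
  by rewrite integral0.
rewrite tonelli_swap//; apply: eq_integral => y _; rewrite /g.
case: ifP => // y0.
by rewrite integral0_eq// => x _; rewrite if_same.
Qed.

Lemma measurable_ipos : measurable_fun setT (fun x : measurableTypeR R => if 0 < x
    then ipos (f x) else 0%E).
Proof.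
have := measurable_tonelli1 mu mg g0; congr measurable_fun; apply/funext => x.
by rewrite /g; case: ifP => //; rewrite integral0.
Qed.
End ipos_swap.

Section gagliardo.
Context (R : realType).
Local Notation mu := (@lebesgue_measure R).
Local Notation S n := (surface_measure (@unit_sphere R n)).

Lemma measurable_fun_vec_sub d (T : measurableType d) n (f g : T -> Rvec R n) :
  measurable_fun setT f -> measurable_fun setT g ->
  measurable_fun setT (fun x => vec_sub (f x) (g x)).
Proof.
move=> mf mg; apply/measurable_fun_tnthP => i.
have -> : (tnth (T:=measurableTypeR R))^~ i \o (fun x => vec_sub (f x) (g x)) =
    (fun x => tnth (f x) i - tnth (g x) i).
  by apply/funext => x; rewrite /= tnth_mktuple.
by apply: measurable_funB; exact: measurable_fun_tnth.
Qed.

Lemma measurable_fun_enorm d (T : measurableType d) n (f : T -> Rvec R n) :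
  measurable_fun setT f -> measurable_fun setT (fun x => enorm (f x)).
Proof. exact: (measurableT_comp (@measurable_enorm R n)). Qed.

Lemma enorm_subC n (x y : Rvec R n) : enorm (vec_sub x y) = enorm (vec_sub y x).
Proof.
rewrite !enormE; congr Num.sqrt; apply: eq_bigr => i _.
by rewrite !tnth_mktuple -sqrrN opprB.
Qed.

(* Tonelli folds the region [|y| < |x|] onto [|x| < |y|]; then [|x| = r t] and
   [|y| = r]. *)
Lemma gagliardo_radial n (s p alpha beta : R) (U : R -> R) :
  0 < p -> measurable_fun setT U ->
  gagliardo_pow s p alpha beta (fun x : Rvec R n.+1 => U (enorm x)) =
  (S n.+1 * ipos (fun t => if (t < 1)%R then
     ((t `^ alpha + t `^ beta) * t `^ n%:R)%:E * Phi n.+1 s p t *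
     ipos (fun r => (`|U (r * t)%R - U r| `^ p *
               r `^ (n.+1%:R + alpha + beta - s * p - 1))%:E)
     else 0))%E.
Proof.
move=> p0 mU; rewrite /gagliardo_pow.
pose q := n.+1%:R + s * p.
pose k (x y : Rvec R n.+1) : \bar R :=
  (`|U (enorm x) - U (enorm y)| `^ p * enorm (vec_sub x y) `^ (- q) *
   enorm x `^ alpha * enorm y `^ beta)%:E.
have k0 x y : (0 <= k x y)%E by rewrite lee_fin !mulr_ge0 ?powR_ge0.
have mUe d (T : measurableType d) (f : T -> Rvec R n.+1) : measurable_fun setT f ->
    measurable_fun setT (fun x => U (enorm (f x))).
  by move=> mf; apply: (measurableT_comp mU); exact: measurable_fun_enorm.
have mk d (T : measurableType d) (f g : T -> Rvec R n.+1) :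
    measurable_fun setT f -> measurable_fun setT g ->
    measurable_fun setT (fun x => k (f x) (g x)).
  move=> mf mg; rewrite /k.
  have h1 := mUe _ _ _ mf; have h2 := mUe _ _ _ mg.
  have h3 := measurable_fun_enorm mf; have h4 := measurable_fun_enorm mg.
  have h5 := measurable_fun_enorm (measurable_fun_vec_sub mf mg).
  by meas.
have me (d : measure_display) (T : measurableType d) (f : T -> Rvec R n.+1) :
    measurable_fun setT f ->
    measurable_fun setT (fun x => enorm (f x)).
  exact: measurable_fun_enorm.
pose k1 x y : \bar R := if enorm x < enorm y then k x y else 0%E.
pose k2 x y : \bar R := if enorm y < enorm x then k x y else 0%E.
have mk1 d (T : measurableType d) (f g : T -> Rvec R n.+1) :
    measurable_fun setT f -> measurable_fun setT g ->
    measurable_fun setT (fun x => k1 (f x) (g x)).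
  move=> mf mg; rewrite /k1; have h1 := mk _ _ _ _ mf mg.
  have h3 := me _ _ _ mf; have h4 := me _ _ _ mg; by meas.
have mk2 d (T : measurableType d) (f g : T -> Rvec R n.+1) :
    measurable_fun setT f -> measurable_fun setT g ->
    measurable_fun setT (fun x => k2 (f x) (g x)).
  move=> mf mg; rewrite /k2; have h1 := mk _ _ _ _ mf mg.
  have h3 := me _ _ _ mf; have h4 := me _ _ _ mg; by meas.
have k10 x y : (0 <= k1 x y)%E by rewrite /k1; case: ifP.
have k20 x y : (0 <= k2 x y)%E by rewrite /k2; case: ifP.
transitivity (\int[lebesgue_vec R n.+1]_x
   (\int[lebesgue_vec R n.+1]_y k1 x y + \int[lebesgue_vec R n.+1]_y k2 x y))%E.
  apply: eq_integral => x _; rewrite -ge0_integralD//; last 2 first.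
  - exact: (mk1 _ _ (fun=> x) id).
  - exact: (mk2 _ _ (fun=> x) id).
  apply: eq_integral => y _; rewrite /k1 /k2.
  have [xy|xy|xy] := ltgtP (enorm x) (enorm y).
  - by rewrite adde0 /k powRN.
  - by rewrite add0e /k powRN.
  (* On |x| = |y| the increment of the radial function is 0, and so is its power because p > 0. *)
  - by rewrite xy subrr normr0 powR0 ?gt_eqF// !mul0r adde0.
rewrite ge0_integralD//; last 4 first.
- by move=> x _; apply: integral_ge0.
- by apply: measurable_tonelli1 => //; exact: mk1.
- by move=> x _; apply: integral_ge0.
- by apply: measurable_tonelli1 => //; exact: mk2.
rewrite [X in (X + _)%E]tonelli_swap//; last exact: mk1.
rewrite -ge0_integralD//; last 4 first.
- by move=> x _; apply: integral_ge0.
- by apply: measurable_tonelli2 => //; exact: mk1.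
- by move=> x _; apply: integral_ge0.
- by apply: measurable_tonelli1 => //; exact: mk2.
pose A t := ((t `^ alpha + t `^ beta) * t `^ n%:R)%:E.
pose D r t := `|U (r * t)%R - U r| `^ p.
pose e := n.+1%:R + alpha + beta - s * p - 1.
(* The inner integrand at |y| = r, in the variable t = |x| / r. Its exponent e - n = alpha + beta -
   s p becomes e after the factor r^n of the polar coordinates of y. *)
pose F r t : \bar R := if t < 1 then (A t * Phi n.+1 s p t * (D r t * r `^ (e -
    n%:R))%:E)%E else 0%E.
have A0 t : (0 <= A t)%E by rewrite lee_fin mulr_ge0 ?addr_ge0 ?powR_ge0.
have AP0 t : (0 <= A t * Phi n.+1 s p t)%E by rewrite mule_ge0 ?Phi_ge0.
have F0 r t : (0 <= F r t)%E.
  rewrite /F; case: ifP => // _; rewrite mule_ge0//.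
  by rewrite lee_fin mulr_ge0// powR_ge0.
have mP d (T : measurableType d) (f : T -> R) : measurable_fun setT f ->
    measurable_fun setT (fun x => Phi n.+1 s p (f x)).
  exact: (measurableT_comp (@measurable_Phi R n s p)).
have mUc d (T : measurableType d) (f : T -> R) : measurable_fun setT f ->
    measurable_fun setT (fun x => U (f x)).
  exact: (measurableT_comp mU).
have mF : measurable_fun setT (fun z : measurableTypeR R * measurableTypeR R => F
    z.1 z.2).
  rewrite /F /A /D.
  have h1 : measurable_fun setT (fun z : measurableTypeR R * measurableTypeR R =>
      Phi n.+1 s p z.2).
    by apply: mP; meas.
  have h2 : measurable_fun setT (fun z : measurableTypeR R * measurableTypeR R => U
      (z.1 * z.2)).
    by apply: mUc; meas.
  have h3 : measurable_fun setT (fun z : measurableTypeR R * measurableTypeR R => U z.1).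
    by apply: mUc; meas.
  by meas.
pose Th rho := (if (0 < rho)%R then ipos (F rho) else 0)%E.
transitivity (\int[lebesgue_vec R n.+1]_y Th (enorm y))%E.
  apply: eq_integral => y _; rewrite -ge0_integralD//; last 2 first.
  - exact: (mk1 _ _ id (fun=> y)).
  - exact: (mk2 _ _ (fun=> y) id).
  rewrite /Th; case: ifPn => [y0|]; last first.
    rewrite -leNgt => y0; rewrite integral0_eq// => x _.
    by rewrite /k1 /k2 ltNge (le_trans y0) ?enorm_ge0// adde0.
  pose f r := (`|U r - U (enorm y)| `^ p *
    (r `^ alpha * enorm y `^ beta + enorm y `^ alpha * r `^ beta))%:E.
  transitivity (\int[lebesgue_vec R n.+1]_x (if (enorm x < enorm y)%R then
      f (enorm x) * (enorm (vec_sub x y) `^ (- q))%:E else 0))%E.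
    apply: eq_integral => x _; rewrite /k1 /k2; case: ifP => _; last by rewrite adde0.
    rewrite /k /f -EFinD -EFinM (enorm_subC y x) (distrC (U (enorm y))).
    have E (a1 a2 a3 a4 a5 a6 : R) :
      a1 * a2 * a3 * a4 + a1 * a2 * a5 * a6 = a1 * (a3 * a4 + a5 * a6) * a2.
      by ring.
    by rewrite E.
  rewrite integral_kernel//; last 2 first.
  - have h : measurable_fun setT (fun z : measurableTypeR R => U z) by exact: mU.
    by rewrite /f; meas.
  - by move=> r; rewrite lee_fin mulr_ge0 ?addr_ge0// ?mulr_ge0 ?powR_ge0.
  rewrite -iposZl//; last 3 first.
  - have h1 : measurable_fun setT (fun z : measurableTypeR R => Phi n.+1 s p z) by
        exact: measurable_Phi.
    have h2 : measurable_fun setT (fun z : measurableTypeR R => U (enorm y * z)).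
      by apply: mUc; meas.
    by rewrite /f; meas.
  - by rewrite lee_fin powR_ge0.
  - move=> r r0; case: ifP => // _; rewrite mule_ge0 ?Phi_ge0//.
    by rewrite lee_fin !mulr_ge0 ?addr_ge0// ?mulr_ge0 ?powR_ge0.
  apply: eq_ipos => t t0; rewrite /F; case: ifP => _; last by rewrite mule0.
  rewrite muleA muleC [RHS]muleAC muleC; congr (_ * _)%E.
  rewrite /A /f /D -!EFinM; congr EFin.
  rewrite !powRM ?(ltW y0) ?(ltW t0)//.
  rewrite (_ : e - n%:R = alpha + beta + - (s * p)); last by rewrite /e -natr1; ring.
  by rewrite !gt0_powRD//; ring.
have mTh : measurable_fun setT (Th : measurableTypeR R -> \bar R).
  exact: measurable_ipos.
rewrite integral_enorm//; last first.
  by move=> r; rewrite /Th; case: ifP => // _; exact: ipos_ge0.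
congr (_ * _)%E.
transitivity (ipos (fun r => ipos (fun t => (r `^ n%:R)%:E * F r t)))%E.
  apply: eq_ipos => r r0; rewrite /Th r0 muleC iposZl//.
  - exact: (measurableT_comp mF (pair1_measurable r)).
  - by rewrite lee_fin powR_ge0.
rewrite ipos_swap; last 2 first.
- by meas.
- by move=> r t _ _; rewrite mule_ge0// lee_fin powR_ge0.
apply: eq_ipos => t t0; rewrite /F; case: ifP => t1; last first.
  by rewrite /ipos integral0_eq// => r _; rewrite mule0 if_same.
rewrite -iposZl//.
- apply: eq_ipos => r r0; rewrite muleCA -EFinM mulrCA -gt0_powRD//.
  by congr (_ * (_ * _ `^ _)%:E)%E; rewrite /e; ring.
- have h2 : measurable_fun setT (fun z : measurableTypeR R => U (z * t)).
    by apply: mUc; meas.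
  by meas.
- exact: AP0.
- by move=> r r0; rewrite lee_fin mulr_ge0 ?powR_ge0.
Qed.
End gagliardo.

(** * Finiteness of the Hardy constant *)

Section hardy_constant.
Context (R : realType).
Local Notation mu := (@lebesgue_measure R).
Local Notation S n := (surface_measure (@unit_sphere R n)).

(** Used to move the singularity of the kernel from y to the origin, where the radial formula
    applies. *)
Lemma integral_vec_translate n (f : Rvec R n -> \bar R) (y : Rvec R n) :
  measurable_fun setT f -> (forall x, (0 <= f x)%E) ->
  (\int[lebesgue_vec R n]_x f (vec_sub x y) = \int[lebesgue_vec R n]_x f x)%E.
Proof.
elim: n f y => [|n IH] f y mf f0.
  by apply: eq_integral => x _; congr f; rewrite [LHS]tuple0 [RHS]tuple0.
have mfs : measurable_fun setT (fun x : Rvec R n.+1 => f (vec_sub x y)).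
  apply: (measurableT_comp mf); apply: measurable_fun_vec_sub => //.
have mfc : measurable_fun setT (fun z => f (cons_vec z)).
  by apply: (measurableT_comp mf); exact: measurable_cons_vec.
rewrite !integral_cons//.
pose g t := (\int[lebesgue_vec R n]_x f (cons_vec (t, x)))%E.
rewrite -[RHS]/(\int[mu]_t g t)%E -[RHS](@integral_translate _ (- thead y))//; last
    2 first.
- by apply: measurable_tonelli1 => //; rewrite (_ : (fun z => _) = (fun z => f
      (cons_vec z)))//; apply/funext => -[].
- by move=> t; exact: integral_ge0.
apply: eq_integral => t _; rewrite /g.
rewrite -[RHS](IH _ [tuple of behead y])//; last first.
  exact: (measurableT_comp mfc (pair1_measurable _)).
apply: eq_integral => x _; congr f.
apply: eq_from_tnth => i; rewrite tnth_mktuple.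
have [j ->|->] := unliftP ord0 i; last by rewrite !tnth0.
rewrite !tnthS tnth_mktuple; congr (_ - _).
by rewrite [in LHS](tuple_eta y) tnthS; congr tnth; exact/val_inj.
Qed.

Definition axis_vec n : Rvec R n := [tuple ((i == 0 :> nat)%:R : measurableTypeR R)
    | i < n].

Lemma sqnorm_axis_vec n : sqnorm (axis_vec n.+1) = 1.
Proof.
rewrite /sqnorm big_ord_recl tnth_mktuple/= expr1n big1 ?addr0// => i _.
by rewrite tnth_mktuple/= expr0n.
Qed.

Lemma dotZr n (a : R) (x y : Rvec R n) : dot x (vec_scale a y) = a * dot x y.
Proof.
rewrite /dot mulr_sumr; apply: eq_bigr => i _.
by rewrite tnth_mktuple mulrCA.
Qed.

(** Cauchy-Schwarz, from the nonnegativity of |x - (x.y) y|^2. *)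
Lemma normr_dot_le n (x y : Rvec R n) : sqnorm y = 1 -> `|dot x y| <= enorm x.
Proof.
move=> y1; rewrite enormE -sqrtr_sqr ler_wsqrtr// -subr_ge0.
have := sqnorm_ge0 (vec_sub x (vec_scale (dot x y) y)).
by rewrite sqnorm_sub dotZr sqnorm_scale y1 => h; rewrite (le_trans h)//; lra.
Qed.

Lemma enorm_sub_ge n (x y : Rvec R n) : sqnorm y = 1 ->
  `|1 - enorm x| <= enorm (vec_sub x y).
Proof.
move=> y1; rewrite [leRHS]enormE -sqrtr_sqr ler_wsqrtr// sqnorm_sub y1 -enorm_sqr.
by have := normr_dot_le x y1; rewrite ler_norml => /andP[_ ?]; nra.
Qed.

Lemma enorm_sub_le n (x y : Rvec R n) : sqnorm y = 1 ->
  enorm (vec_sub x y) <= enorm x + 1.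
Proof.
move=> y1; have e0 := enorm_ge0 x.
rewrite [leLHS]enormE -(ger0_norm (addr_ge0 e0 ler01)) -sqrtr_sqr ler_wsqrtr//.
rewrite sqnorm_sub y1 -enorm_sqr.
by have := normr_dot_le x y1; rewrite ler_norml => /andP[? _]; nra.
Qed.

(** Here ln (1 / t) <= 1 / t - 1 = (1 - t) / t, and 1 / t <= 2. *)
Lemma ln_half1 (t : R) : 1 / 2 <= t -> t <= 1 -> `|ln t| <= 2 * (1 - t).
Proof.
move=> t2 t1; have t0 : 0 < t by lra.
have lt0 : ln t <= 0 by exact: ln_le0.
rewrite ler0_norm// -lnV ?posrE//.
have : ln (1 + (t^-1 - 1)) <= t^-1 - 1.
  by apply: le_ln1Dx; rewrite -subr_gt0 opprK subrK invr_gt0.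
rewrite addrC subrK => /le_trans; apply.
rewrite -(ler_pM2r t0) mulrBl mulVf ?gt_eqF// mul1r; nra.
Qed.

Lemma powR_half1 (c t : R) : 1 / 2 <= t -> t <= 1 -> t `^ c <= expR `|c|.
Proof.
move=> t2 t1; have t0 : 0 < t by lra.
rewrite /powR gt_eqF// ler_expR (le_trans (ler_norm _))// normrM.
have := ln_half1 t2 t1; have := normr_ge0 c; nra.
Qed.

Lemma expR_sub1_le (u : R) : `|expR u - 1| <= `|u| * expR `|u|.
Proof.
have h1 := expR_ge1Dx u; have h2 := expR_ge1Dx (- u).
have e1 : expR (- u) * expR u = 1 by rewrite -expRD addNr expR0.
have e0 := expR_gt0 u.
have [u0|u0] := leP 0 u.
  rewrite !ger0_norm//; last by rewrite subr_ge0; lra.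
  have : (1 - u) * expR u <= 1 by rewrite -[leRHS]e1 ler_pM2r.
  by lra.
have u1 : expR u <= 1 by rewrite expR_le1 ltW.
rewrite ler0_norm ?subr_le0// ltr0_norm// opprB.
have : 1 <= expR (- u) by lra.
by nra.
Qed.

(** The factor 1 - t, raised to the power p, compensates the singularity of the kernel at the unit
    sphere. *)
Lemma powR_sub1_le (c t : R) : 1 / 2 <= t -> t <= 1 ->
  `|t `^ c - 1| <= 2 * `|c| * expR `|c| * (1 - t).
Proof.
move=> t2 t1; have t0 : 0 < t by lra.
rewrite {1}/powR gt_eqF// (le_trans (expR_sub1_le _))// normrM.
have l1 := ln_half1 t2 t1; have c0 := normr_ge0 c.
have : expR (`|c| * `|ln t|) <= expR `|c|.
  by rewrite ler_expR -[leRHS]mulr1 ler_wpM2l//; lra.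
move=> h; rewrite [leRHS](_ : _ = (`|c| * (2 * (1 - t))) * expR `|c|); last by ring.
by apply: ler_pM => //; rewrite ?mulr_ge0 ?expR_ge0// ler_wpM2l.
Qed.

(** This is the shape of the radial energy formula with the increments of the ground state.
    Extracting t^(- p gamma) from the increment exchanges the alpha and beta terms. *)
Lemma hardy_constE n (s p alpha beta : R) : p != 0 ->
  let gamma := (n.+1%:R + alpha + beta - s * p) / p in
  hardy_const n.+1 s p alpha beta = ipos (fun t => if (t < 1)%R then
    ((t `^ alpha + t `^ beta) * t `^ n%:R)%:E * Phi n.+1 s p t *
     (`|t `^ (- gamma) - 1| `^ p)%:E else 0)%E.
Proof.
move=> p0 gamma; rewrite /hardy_const ipos_itv01; apply: eq_ipos => t t0.
case: ifP => // t1; rewrite -/gamma muleAC -EFinM; congr (EFin _ * _)%E.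
have -> : `|t `^ (- gamma) - 1| `^ p =
    t `^ (- (n.+1%:R + alpha + beta - s * p)) * `|1 - t `^ gamma| `^ p.
  rewrite (_ : t `^ (- gamma) - 1 = t `^ (- gamma) * (1 - t `^ gamma)); last first.
    by rewrite mulrBr mulr1 -gt0_powRD// addNr powRr0.
  rewrite normrM (ger0_norm (powR_ge0 _ _)) powRM ?powR_ge0// -powRrM mulNr.
  by rewrite /gamma mulfVK.
rewrite mulrA; congr (_ * _).
rewrite mulrDr !mulrDl -!gt0_powRD// addrC; congr (_ `^ _ + _ `^ _); rewrite -natr1; ring.
Qed.

Lemma hardy_const_ge0 n (s p alpha beta : R) : (0 <= hardy_const n.+1 s p alpha beta)%E.
Proof.
apply: integral_ge0 => r _; rewrite mule_ge0 ?Phi_ge0// lee_fin.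
by rewrite !mulr_ge0 ?addr_ge0// powR_ge0.
Qed.

(* By [integral_kernel] with [|y| = 1] the constant is an integral over the unit
   ball; near the sphere, [1 - |x| <= |x - y|] makes the integrand at most
   [|x - y| ^ (p - s p - d)], which is integrable at [y]. *)
Lemma hardy_const_lt_pinfty n (s p alpha beta : R) :
  1 <= p -> 0 < s < 1 ->
  - n.+1%:R < alpha < s * p -> - n.+1%:R < beta < s * p ->
  (hardy_const n.+1 s p alpha beta < +oo)%E.
Proof.
move=> p1 /andP[s0 s1] /andP[al1 al2] /andP[be1 be2].
have p0 : 0 < p by lra.
rewrite hardy_constE ?gt_eqF//; set gamma := (_ / p).
pose y := axis_vec n.+1; have y1 : sqnorm y = 1 := sqnorm_axis_vec n.
have ey1 : enorm y = 1 by rewrite enormE y1 sqrtr1.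
pose fr r := (r `^ alpha + r `^ beta) * `|r `^ (- gamma) - 1| `^ p.
have fr0 r : 0 <= fr r by rewrite mulr_ge0 ?addr_ge0// powR_ge0.
pose k := n.+1%:R + s * p.
have k0 : 0 < k by rewrite addr_gt0// mulr_gt0.
have mfr : measurable_fun setT (fun r : measurableTypeR R => fr r) by rewrite /fr; meas.
have -> : ipos (fun t => if (t < 1)%R then
    ((t `^ alpha + t `^ beta) * t `^ n%:R)%:E * Phi n.+1 s p t *
     (`|t `^ (- gamma) - 1| `^ p)%:E else 0)%E =
  (\int[lebesgue_vec R n.+1]_x (if (enorm x < 1)%R then
     (fr (enorm x))%:E * (enorm (vec_sub x y) `^ (- k))%:E else 0))%E.
  rewrite -ey1 (@integral_kernel _ n s p (fun r => (fr r)%:E))//; last 2 first.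
  - by rewrite ey1.
  - by meas.
  rewrite ey1 powR1 mul1e; apply: eq_ipos => t t0; case: ifP => // _.
  rewrite muleAC.
  rewrite mul1r.
  rewrite -!EFinM.
  rewrite /fr.
  congr (EFin _ * _)%E.
  by rewrite mulrAC.
(* For 1/2 <= |x| < 1, [powR_half1] bounds the two weights and [powR_sub1_le] the increment. *)
pose K := (expR `|alpha| + expR `|beta|) * (2 * `|gamma| * expR `|gamma|) `^ p.
have K0 : 0 <= K by rewrite mulr_ge0 ?addr_ge0 ?expR_ge0// powR_ge0.
(* [g1] is for |x| <= 1/2, where |x - y| >= 1/2 bounds the kernel by 2^k. [g2] is for the rest of
   the ball, where |x - y| <= |x| + 1 <= 2. *)
pose g1 r := if r <= 1 / 2 then fr r else 0.
pose g2 r := if r <= 2 then r `^ (p - k) else 0.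
have g10 r : 0 <= g1 r by rewrite /g1; case: ifP.
have g20 r : 0 <= g2 r by rewrite /g2; case: ifP => // _; rewrite powR_ge0.
have mg1 : measurable_fun setT (fun r : measurableTypeR R => g1 r) by rewrite /g1; meas.
have mg2 : measurable_fun setT (fun r : measurableTypeR R => g2 r) by rewrite /g2; meas.
have me : measurable_fun setT (fun x : Rvec R n.+1 => enorm x) by exact: measurable_enorm.
have mes : measurable_fun setT (fun x : Rvec R n.+1 => enorm (vec_sub x y)).
  by apply: (measurableT_comp me); exact: measurable_fun_vec_sub.
have mg1e : measurable_fun setT (fun x : Rvec R n.+1 => g1 (enorm x)).
  exact: (measurableT_comp mg1).
have mg2e : measurable_fun setT (fun x : Rvec R n.+1 => g2 (enorm x)).
  exact: (measurableT_comp mg2).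
have mg2s : measurable_fun setT (fun x : Rvec R n.+1 => g2 (enorm (vec_sub x y))).
  exact: (measurableT_comp mg2).
apply: (@le_lt_trans _ _ (\int[lebesgue_vec R n.+1]_x
   ((2 `^ k)%:E * (g1 (enorm x))%:E + K%:E * (g2 (enorm (vec_sub x y)))%:E))%E).
  apply: ge0_le_integral => //.
  - move=> x _; case: ifP => // _; rewrite mule_ge0// lee_fin ?fr0 ?powR_ge0//.
  - have := measurableT_comp mfr me => /= h.
    by meas.
  - by meas.
  - move=> x _; case: ifPn => [x1|_]; last first.
      by rewrite adde_ge0// mule_ge0// lee_fin// powR_ge0.
    have dge := enorm_sub_ge x y1.
    rewrite ger0_norm in dge; last by rewrite subr_ge0 ltW.
    have d0 : 0 < enorm (vec_sub x y) by rewrite (lt_le_trans _ dge)// subr_gt0.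
    rewrite -!EFinM -EFinD lee_fin /g1; case: (leP (enorm x) (1 / 2)) => x2.
      rewrite -[leLHS]addr0 lerD ?mulr_ge0// mulrC ler_wpM2r//.
      rewrite powRN -div1r ler_pdivrMr ?powR_gt0//.
      have E : 2 `^ k * (1 / 2) `^ k = 1.
        by rewrite -powRM// mulrCA divff ?mulr1 ?powR1// pnatr_eq0.
      rewrite -[leLHS]E.
      apply: ler_wpM2l; first exact: powR_ge0.
      by apply: ge0_ler_powR; rewrite ?nnegrE ?(ltW k0) ?(ltW d0)//; lra.
    rewrite mulr0 add0r /g2 ifT; last first.
      by rewrite (le_trans (enorm_sub_le x y1))//; lra.
    rewrite gt0_powRD// mulrA ler_wpM2r ?powR_ge0// /fr /K -[leRHS]mulrA.
    apply: ler_pM => //; rewrite ?addr_ge0 ?powR_ge0//.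
      by apply: lerD; apply: powR_half1; exact: ltW.
    rewrite -powRM ?(ltW d0) ?mulr_ge0 ?expR_ge0//.
    apply: ge0_ler_powR; rewrite ?nnegrE ?(ltW p0) ?mulr_ge0 ?expR_ge0 ?(ltW d0)//.
    apply: le_trans (powR_sub1_le (- gamma) (ltW x2) (ltW x1)) _.
    by rewrite normrN ler_wpM2l ?mulr_ge0 ?expR_ge0.
rewrite ge0_integralD//; last 4 first.
- by move=> x _; rewrite mule_ge0// lee_fin// powR_ge0.
- by meas.
- by move=> x _; rewrite mule_ge0// lee_fin.
- by meas.
rewrite !ge0_integralZl//; last 4 first.
- by meas.
- by move=> x _; rewrite lee_fin.
- by meas.
- by move=> x _; rewrite lee_fin.
have Sfin : S n.+1 \is a fin_num.
  by rewrite ge0_fin_numE ?sphere_lt_pinfty// ltW// sphere_gt0.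
have S0 : (0 <= S n.+1)%E by rewrite ltW// sphere_gt0.
rewrite lte_add_pinfty//; apply: lte_mul_pinfty => //; rewrite ?lee_fin ?powR_ge0//.
- rewrite (@integral_enorm _ n (fun r => (g1 r)%:E))//; last by meas.
  apply: lte_mul_pinfty => //.
  pose h a r : \bar R := if (r <= 1 / 2)%R then (r `^ (a - 1))%:E else 0%E.
  have mh a : measurable_fun setT (h a : measurableTypeR R -> \bar R) by rewrite /h; meas.
  have h0 a r : (0 <= h a r)%E by rewrite /h; case: ifP => // _; rewrite lee_fin powR_ge0.
  have hoo a : 0 < a -> (ipos (h a) < +oo)%E.
    by move=> a0; rewrite ipos_le_powR// ?ltry.
  (* Expanding (r^alpha + r^beta) (r^(- p gamma) + 1) r^n leaves four powers, integrable at 0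
     because alpha and beta lie strictly between -d and s p. *)
  apply: (@le_lt_trans _ _ (ipos (fun r => (h (s * p - beta)%R r + h (n.+1%:R +
      alpha)%R r) +
     (h (s * p - alpha)%R r + h (n.+1%:R + beta)%R r)))%E).
    apply: le_ipos; [by meas|by meas| |].
      by move=> r r0; rewrite mule_ge0// lee_fin ?powR_ge0.
    move=> r r0; rewrite /g1 /h; case: ifP => r2; last by rewrite mul0e !adde0.
    rewrite -!EFinM -!EFinD lee_fin /fr.
    have hp : `|r `^ (- gamma) - 1| `^ p <= r `^ (- (n.+1%:R + alpha + beta - s * p)) + 1.
      have -> : r `^ (- (n.+1%:R + alpha + beta - s * p)) = (r `^ (- gamma)) `^ p.
        by rewrite -powRrM mulNr /gamma mulfVK// gt_eqF.
      have e0 := powR_ge0 r (- gamma).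
      have [e1|e1] := leP (r `^ (- gamma)) 1.
        rewrite (@le_trans _ _ 1) ?lerDr ?powR_ge0// -[leRHS](congr1 (fun h => h p)
            (powR1 R)).
        by apply: ge0_ler_powR; rewrite ?nnegrE ?(ltW p0)// ler0_norm; lra.
      rewrite (@le_trans _ _ ((r `^ (- gamma)) `^ p)) ?lerDl//.
      by apply: ge0_ler_powR; rewrite ?nnegrE ?(ltW p0)// ger0_norm; lra.
    apply: (@le_trans _ _ ((r `^ alpha + r `^ beta) * (r `^ (- (n.+1%:R + alpha +
        beta - s * p)) + 1) * r `^ n%:R)).
      by rewrite ler_wpM2r ?powR_ge0// ler_wpM2l ?addr_ge0 ?powR_ge0.
    have E (a b X c : R) : (a + b) * (X + 1) * c = (a * X * c + a * c) + (b * X * c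
        + b * c).
      by ring.
    rewrite E -!gt0_powRD// -natr1 le_eqVlt; apply/orP; left; apply/eqP.
    by congr (_ `^ _ + _ `^ _ + (_ `^ _ + _ `^ _)); ring.
  rewrite iposD//; [|by meas|by meas|by move=> r _; rewrite adde_ge0|by move=> r _;
      rewrite adde_ge0].
  rewrite !iposD; [|exact: mh|exact: mh|by move=> r _|by move=> r _
    |exact: mh|exact: mh|by move=> r _|by move=> r _].
  have := hoo (s * p - beta); have := hoo (s * p - alpha).
  have := hoo (n.+1%:R + alpha); have := hoo (n.+1%:R + beta).
  by move=> h1 h2 h3 h4; apply: lte_add_pinfty; apply: lte_add_pinfty;
    [apply: h4|apply: h2|apply: h3|apply: h1]; lra.
- rewrite [ltLHS](@integral_vec_translate _ (fun x => (g2 (enorm x))%:E) y);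
    [|by meas|by move=> x; rewrite lee_fin].
  rewrite (@integral_enorm _ n (fun r => (g2 r)%:E))//; last by meas.
  apply: lte_mul_pinfty => //.
  (* The radial exponent is p - k + n = p - s p - 1, integrable at 0 because s < 1. *)
  rewrite (_ : ipos _ = (((p - s * p)^-1 * 2 `^ (p - s * p))%:E)) ?ltry//.
  rewrite -ipos_le_powR//; last by rewrite subr_gt0; nra.
  apply: eq_ipos => r r0; rewrite /g2; case: ifP => _; last by rewrite mul0e.
  rewrite -EFinM -gt0_powRD//; congr (_ `^ _)%:E; rewrite /k -natr1; ring.
Qed.
End hardy_constant.

(** * The truncated ground state *)

Section profile.
Context (R : realType).
Local Notation mu := (@lebesgue_measure R).

(* [clamp b w] is the [T w], and [tent b w] the [F w], of the header. *)
Definition clamp (b w : R) : R := Num.min (Num.max w 1) (2 * b - 1) - 1.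
Definition tent (b w : R) : R := Num.min (clamp b w) (2 * b - 2 - clamp b w).

Lemma minr_case (x y : R) :
  (x <= y /\ Num.min x y = x) \/ (y <= x /\ Num.min x y = y).
Proof.
by have [xy|/ltW yx] := leP x y; [left|right]; rewrite ?min_l ?min_r.
Qed.

Lemma maxr_case (x y : R) :
  (x <= y /\ Num.max x y = y) \/ (y <= x /\ Num.max x y = x).
Proof.
by have [xy|/ltW yx] := leP x y; [left|right]; rewrite ?max_l ?max_r.
Qed.

Ltac case_max := repeat match goal with |- context [Order.max ?x ?y] =>
  case: (maxr_case x y) => -[? ->] end.
Ltac case_min := repeat match goal with |- context [Order.min ?x ?y] =>
  case: (minr_case x y) => -[? ->] end.

Lemma clamp_ge0 b w : 1 <= b -> 0 <= clamp b w.
Proof. by move=> b1; rewrite /clamp; case_max; case_min; lra. Qed.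

Lemma clamp_le b w : clamp b w <= 2 * b - 2.
Proof. by rewrite /clamp; case_max; case_min; lra. Qed.

Lemma clampE b w : 1 <= w -> w <= b -> clamp b w = w - 1.
Proof. by move=> w1 wb; rewrite /clamp; case_max; case_min; lra. Qed.

Lemma clamp_eq0 b w : 1 <= b -> w <= 1 -> clamp b w = 0.
Proof. by move=> b1 w1; rewrite /clamp; case_max; case_min; lra. Qed.

Lemma clamp_le2 b x y : x <= y -> clamp b x <= clamp b y.
Proof. by move=> xy; rewrite /clamp; case_max; case_min; lra. Qed.

Lemma clamp_lip b x y : x <= y -> clamp b y - clamp b x <= y - x.
Proof. by move=> xy; rewrite /clamp; case_max; case_min; lra. Qed.

Lemma clamp_le_arg b w : 1 <= b -> 0 <= w -> clamp b w <= w.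
Proof. by move=> b1 w0; rewrite /clamp; case_max; case_min; lra. Qed.

Lemma tent_ge0 b w : 1 <= b -> 0 <= tent b w.
Proof.
move=> b1; have := clamp_ge0 w b1; have := clamp_le b w; rewrite /tent.
by case_min; lra.
Qed.

Lemma tent_le_clamp b w : tent b w <= clamp b w.
Proof. by rewrite ge_min lexx. Qed.

Lemma tentE b w : 1 <= w -> w <= b -> tent b w = w - 1.
Proof. by move=> w1 wb; rewrite /tent clampE// min_l//; lra. Qed.

(** The two bounds keep the test functions supported away from the origin and from infinity,
    whatever the sign of gamma. *)
Lemma tent_supp b w : 1 <= b -> tent b w != 0 -> 1 <= w <= 2 * b - 1.
Proof.
move=> b1 h; apply/andP; split; rewrite leNgt; apply: contra h => h.
  by rewrite /tent clamp_eq0 ?(ltW h)// min_l//; lra.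
have -> : tent b w = Num.min (2 * b - 2) 0.
  have E : clamp b w = 2 * b - 2 by rewrite /clamp; case_max; case_min; lra.
  by rewrite /tent E subrr.
by rewrite min_r//; lra.
Qed.

(** The tent is the truncation followed by z |-> min (z, 2 b - 2 - z), which is 1-Lipschitz. *)
Lemma tent_clamp b x y : `|tent b x - tent b y| <= `|clamp b x - clamp b y|.
Proof.
rewrite ler_norml; have := ler_norm (clamp b x - clamp b y).
have := ler_norm (clamp b y - clamp b x); rewrite (distrC (clamp b y)) => h1 h2.
by apply/andP; split; rewrite /tent; case_min; lra.
Qed.

Lemma tent_lip b x y : `|tent b x - tent b y| <= `|x - y|.
Proof.
apply: le_trans (tent_clamp b x y) _.
wlog xy : x y / x <= y.
  by move=> H; have [xy|/ltW yx] := leP x y; [exact: H|rewrite distrC [leRHS]distrC H].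
rewrite distrC [leRHS]distrC !ger0_norm ?subr_ge0//; last exact: clamp_le2.
exact: clamp_lip.
Qed.

(** Young's inequality for the product (1 - v) * 1 with exponents P and P / (P - 1); the case P = 1,
    without finite conjugate exponent, is an equality. *)
Lemma bernoulli_powR (P v : R) : 1 <= P -> 0 <= v <= 1 -> 1 - P * v <= (1 - v) `^ P.
Proof.
move=> P1 /andP[v0 v1].
have [P1'|P1'] := leP P 1.
  by rewrite (_ : P = 1) ?mul1r ?powRr1 ?subr_ge0//; apply/eqP; rewrite eq_le P1'.
have P0 : 0 < P by exact: lt_trans P1'.
have P10 : 0 < P - 1 by rewrite subr_gt0.
have q0 : 0 < P / (P - 1) by rewrite divr_gt0.
have E : P^-1 + (P / (P - 1))^-1 = 1.
  by rewrite invf_div -{1}[P^-1]mul1r -mulrDl addrC subrK divff ?gt_eqF.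
have v1' : 0 <= 1 - v by rewrite subr_ge0.
have := conjugate_powR v1' ler01 P0 q0 E; rewrite mulr1 powR1 mul1r invf_div => h.
have : (1 - v) * P <= ((1 - v) `^ P / P + (P - 1) / P) * P by rewrite ler_wpM2r// ltW.
by rewrite [leRHS]mulrDl !divfK ?gt_eqF//; lra.
Qed.

(** The A of the overview. [tent_mass] serves for the Hardy term with P = p and for the right-hand
    side with P = q. *)
Definition clamp_mass b : \bar R := ipos (fun v => (clamp b v^-1)%:E).
Definition tent_mass b P : \bar R :=
  ipos (fun v => (tent b v^-1 `^ P * v `^ (P - 1))%:E).

Lemma measurable_fun_clamp d (T : measurableType d) b (f : T -> R) :
  measurable_fun setT f -> measurable_fun setT (fun x => clamp b (f x)).
Proof.
move=> mf; apply: measurable_funB; last by meas.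
by apply: measurable_minr; [apply: measurable_maxr; meas|meas].
Qed.

Lemma measurable_fun_tent d (T : measurableType d) b (f : T -> R) :
  measurable_fun setT f -> measurable_fun setT (fun x => tent b (f x)).
Proof.
move=> mf; have mc := measurable_fun_clamp b mf.
by apply: measurable_minr; meas.
Qed.

Lemma clamp_mass_ge0 b : 1 <= b -> (0 <= clamp_mass b)%E.
Proof. by move=> b1; apply: ipos_ge0 => v _; rewrite lee_fin clamp_ge0. Qed.

Lemma tent_mass_ge0 b P : (0 <= tent_mass b P)%E.
Proof. by apply: ipos_ge0 => v _; rewrite lee_fin mulr_ge0 ?powR_ge0. Qed.

Let mclamp b : measurable_fun setT (fun v : measurableTypeR R => (clamp b v^-1)%:E).
Proof. by apply: measurable_fun_EFin; apply: measurable_fun_clamp; meas. Qed.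

Let mtent b P : measurable_fun setT (fun v : measurableTypeR R => (tent b v^-1 `^ P
    * v `^ (P - 1))%:E).
Proof.
have h : measurable_fun setT (fun v : measurableTypeR R => tent b v^-1).
  by apply: measurable_fun_tent; meas.
by meas.
Qed.

Lemma clamp_mass_lt_pinfty b : 1 <= b -> (clamp_mass b < +oo)%E.
Proof.
move=> b1.
apply: (@le_lt_trans _ _ (ipos (fun v => (2 * b - 2)%:E * (if (v <= 1)%R then 1
    else 0))%E)).
  apply: le_ipos; [exact: mclamp|by meas| |].
    by move=> v _; rewrite lee_fin clamp_ge0.
  move=> v v0; case: ifPn => v1; first by rewrite mule1 lee_fin clamp_le.
  rewrite mule0 clamp_eq0// invf_le1//; rewrite -ltNge in v1; exact: ltW.
rewrite iposZl//.
- by rewrite ipos_le_cst// mule1 ltry.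
- by meas.
- by rewrite lee_fin; lra.
- by move=> r _; case: ifP.
Qed.

(** Since F(w) <= T(w) <= w, the factor (F(1 / v) v)^(P - 1) is at most 1. *)
Lemma tent_mass_le b P : 1 <= b -> 1 <= P -> (tent_mass b P <= clamp_mass b)%E.
Proof.
move=> b1 P1; apply: le_ipos; [exact: mtent|exact: mclamp| |].
  by move=> v v0; rewrite lee_fin mulr_ge0// powR_ge0.
move=> v v0; rewrite lee_fin (le_trans _ (tent_le_clamp _ _))//.
have t0 := tent_ge0 v^-1 b1.
have [->|tn0] := eqVneq (tent b v^-1) 0.
  by rewrite powR0 ?mul0r// gt_eqF//; lra.
have t1 : 0 < tent b v^-1 by rewrite lt_def tn0.
have -> : tent b v^-1 `^ P = tent b v^-1 `^ (P - 1) * tent b v^-1.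
  by rewrite powR_mulr// subrK.
rewrite mulrAC -powRM ?(ltW v0)//.
rewrite -[leRHS]mul1r ler_wpM2r//.
rewrite -[leRHS](congr1 (fun h => h (P - 1)) (powR1 R)).
apply: ge0_ler_powR; rewrite ?nnegrE ?mulr_ge0 ?(ltW v0) ?subr_ge0//.
rewrite -ler_pdivlMr// div1r (le_trans (tent_le_clamp _ _))// clamp_le_arg//.
by rewrite invr_ge0 ltW.
Qed.

(* Where [1 <= v^-1 <= b] this is Bernoulli's inequality. *)
Lemma clamp_mass_le b P : 1 <= b -> 1 <= P ->
  (clamp_mass b <= tent_mass b P + (P + 2)%:E)%E.
Proof.
move=> b1 P1; have b0 : 0 < b by lra.
(* Bernoulli loses at most P on ]0, 1]; on ]0, 1 / b] the bound T <= 2 b loses at most 2 in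
   total. *)
pose g v : \bar R := (P%:E * (if (v <= 1)%R then 1 else 0) +
   (2 * b)%:E * (if (v <= b^-1)%R then 1 else 0))%E.
have mg : measurable_fun setT (g : measurableTypeR R -> \bar R) by rewrite /g; meas.
have i0 c v : (0 <= (if (v <= c :> R)%R then 1 else 0 : \bar R))%E by case: ifP.
have g0 v : (0 <= g v)%E by rewrite adde_ge0// mule_ge0// lee_fin; lra.
have -> : (P + 2)%:E = ipos g.
  rewrite /g iposD; [|by meas|by meas|by move=> v _; rewrite mule_ge0// lee_fin; lra..].
  rewrite !iposZl//; try by meas.
  rewrite !ipos_le_cst ?invr_gt0// mule1 -EFinM -EFinD.
  by rewrite mulfK ?gt_eqF.
  by rewrite lee_fin; lra.
  by rewrite lee_fin; lra.
rewrite /tent_mass -iposD; [|exact: mtent|exact: mg| |]; last 2 first.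
- by move=> v v0; rewrite lee_fin mulr_ge0// powR_ge0.
- by move=> v _; exact: g0.
apply: le_ipos.
- exact: mclamp.
- by apply: emeasurable_funD; [exact: mtent|exact: mg].
- by move=> v _; rewrite lee_fin clamp_ge0.
move=> v v0; have t0 : 0 <= tent b v^-1 `^ P * v `^ (P - 1) by rewrite mulr_ge0//
    powR_ge0.
have [v1|v1] := leP v 1; last first.
  rewrite clamp_eq0//; last by rewrite invf_le1// ltW.
  by apply: adde_ge0; [rewrite lee_fin|exact: g0].
rewrite /g v1 mule1; have [vb|vb] := leP v b^-1.
  by rewrite mule1 -!EFinD lee_fin; have := clamp_le b v^-1; lra.
rewrite mule0 adde0 -EFinD lee_fin.
have w1 : 1 <= v^-1 by rewrite invf_ge1.
have wb : v^-1 <= b by rewrite -[leRHS]invrK lef_pV2 ?posrE ?invr_gt0// ltW.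
rewrite clampE// tentE//.
have -> : (v^-1 - 1) `^ P * v `^ (P - 1) = (1 - v) `^ P * v^-1.
  rewrite (_ : v^-1 - 1 = (1 - v) * v^-1); last by rewrite mulrBl mul1r mulfV ?gt_eqF.
  rewrite powRM ?subr_ge0 ?invr_ge0 ?(ltW v0)// -mulrA; congr (_ * _).
  by rewrite -(powR_inv1 (ltW v0)) -powRrM -gt0_powRD//; congr (_ `^ _); ring.
have := @bernoulli_powR P v P1; rewrite (ltW v0) v1 => /(_ isT) h.
have : (1 - P * v) * v^-1 <= (1 - v) `^ P * v^-1 by rewrite ler_wpM2r// invr_ge0 ltW.
rewrite mulrBl mul1r mulfK ?gt_eqF//; lra.
Qed.

(** On [1 / b, 1] the integrand is 1 / v - 1, and 1 / v has integral ln b there. *)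
Lemma clamp_mass_ge b : 1 < b -> ((ln b - 1)%:E <= clamp_mass b)%E.
Proof.
move=> b1; have b0 : 0 < b by lra.
have ib1 : b^-1 < 1 by rewrite invf_lt1.
have -> : (ln b - 1)%:E = (\int[mu]_(v in `[(b^-1)%R, 1%R]) (v^-1)%:E - 1)%E.
  by rewrite integral_inv_itv ?invr_gt0// ln1 lnV ?posrE// sub0r opprK.
rewrite leeBlDr//.
have mi : measurable_fun setT (fun v : measurableTypeR R => (v^-1)%:E) by meas.
rewrite integral_mkcond.
have <- : ipos (fun v : R => if (v <= 1)%R then 1%E else 0%E) = 1%E.
  by rewrite ipos_le_cst.
rewrite /clamp_mass -iposD; [|exact: mclamp|by meas| |]; last 2 first.
- by move=> v _; rewrite lee_fin clamp_ge0// ltW.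
- by move=> v _; case: ifP.
apply: ge0_le_integral => //.
- move=> v _; rewrite patchE; case: ifPn => //; rewrite inE/= in_itv/= => /andP[h _].
  by rewrite lee_fin invr_ge0 (le_trans _ h)// invr_ge0 ltW.
- by apply/(measurable_restrictT _ _).1 => //; exact: measurable_funTS.
- by apply: measurable_pos; apply: emeasurable_funD; [exact: mclamp|meas].
move=> v _; rewrite patchE; case: ifPn; last first.
  by case: ifP => // v0 _; rewrite adde_ge0 ?lee_fin ?clamp_ge0 ?(ltW b1)//; case: ifP.
rewrite inE/= in_itv/= => /andP[h1 h2].
have v0 : 0 < v by rewrite (lt_le_trans _ h1)// invr_gt0.
rewrite v0 h2 -EFinD lee_fin clampE ?subrK// ?invf_ge1//.
by rewrite -[leRHS]invrK lef_pV2 ?posrE ?invr_gt0.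
Qed.

(** The weight v^(p - 1) absorbs p - 1 factors exactly, as |1 / (v l) - 1 / v| v = |1 / l - 1| for
    all v. The remaining increment T(1 / (v l)) - T(1 / v) has a sign independent of v, so its
    absolute value integrates to the difference of two integrals, A / l by dilation and A. *)
Lemma increment_mass_le b p l : 1 <= b -> 1 <= p -> 0 < l ->
  (ipos (fun v => (`|tent b (v * l)^-1 - tent b v^-1| `^ p * v `^ (p - 1))%:E)
   <= (`|l^-1 - 1| `^ p)%:E * clamp_mass b)%E.
Proof.
move=> b1 p1 l0.
pose D v := `|clamp b (v * l)^-1 - clamp b v^-1|.
have mcl : measurable_fun setT (fun v : measurableTypeR R => clamp b (v * l)^-1).
  by apply: measurable_fun_clamp; meas.
have mcl1 : measurable_fun setT (fun v : measurableTypeR R => clamp b v^-1).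
  by apply: measurable_fun_clamp; meas.
have mD : measurable_fun setT (fun v : measurableTypeR R => (D v)%:E).
  by rewrite /D; meas.
have DE : ipos (fun v => (D v)%:E) = (`|l^-1 - 1|%:E * clamp_mass b)%E.
  have fA : clamp_mass b \is a fin_num.
    by rewrite ge0_fin_numE ?clamp_mass_lt_pinfty// clamp_mass_ge0.
  have sc : ipos (fun v => (clamp b (v * l)^-1)%:E) = ((l^-1)%:E * clamp_mass b)%E.
    rewrite /clamp_mass -(ipos_scale l0 (mclamp b)); last first.
      by move=> v _; rewrite lee_fin clamp_ge0.
    rewrite -iposZl//.
    - apply: eq_ipos => v v0; rewrite -!EFinM (mulrC v) mulrCA.
      by rewrite mulVf ?mulr1// gt_eqF.
    - by apply: emeasurable_funM; [apply: measurable_fun_EFin; apply: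
          measurable_fun_clamp; meas|meas].
    - by rewrite lee_fin invr_ge0 ltW.
    - by move=> v _; rewrite mule_ge0// lee_fin ?clamp_ge0// ltW.
  have [l1|l1] := leP l 1.
    have : (ipos (fun v => (D v)%:E) + clamp_mass b = (l^-1)%:E * clamp_mass b)%E.
      rewrite -sc /clamp_mass -iposD; [|exact: mD|exact: mclamp| |]; last 2 first.
      - by move=> v _; rewrite lee_fin normr_ge0.
      - by move=> v _; rewrite lee_fin clamp_ge0.
      apply: eq_ipos => v v0; rewrite -EFinD /D ger0_norm ?subrK//.
      rewrite subr_ge0; apply: clamp_le2; rewrite lef_pV2 ?posrE ?mulr_gt0//.
      by rewrite -[leRHS]mulr1 ler_wpM2l// ltW.
    move/(congr1 (fun x => x - clamp_mass b)%E); rewrite addeK// => ->.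
    rewrite ger0_norm ?subr_ge0 ?invf_ge1// -(fineK fA) -!EFinM -EFinB.
    by rewrite mulrBl mul1r.
  have : (ipos (fun v => (D v)%:E) + (l^-1)%:E * clamp_mass b = clamp_mass b)%E.
    rewrite -sc /clamp_mass -iposD; [|exact: mD|by meas| |]; last 2 first.
    - by move=> v _; rewrite lee_fin normr_ge0.
    - by move=> v _; rewrite lee_fin clamp_ge0.
    apply: eq_ipos => v v0; rewrite -EFinD /D distrC ger0_norm ?subrK//.
    rewrite subr_ge0; apply: clamp_le2; rewrite lef_pV2 ?posrE ?mulr_gt0//.
    by rewrite -[leLHS]mulr1 ler_wpM2l// ltW.
  move/(congr1 (fun x => x - (l^-1)%:E * clamp_mass b)%E).
  rewrite addeK ?fin_numM// => ->.
  rewrite distrC ger0_norm; last by rewrite subr_ge0 invf_le1// ltW.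
  by rewrite -(fineK fA) -!EFinM -EFinB mulrBl mul1r.
have powS (a : R) : 0 <= a -> a `^ p = a `^ (p - 1) * a.
  move=> a0; have [->|an0] := eqVneq a 0.
    by rewrite mulr0 powR0// gt_eqF//; lra.
  by rewrite powR_mulr ?subrK// lt_def an0.
have c0 : 0 <= `|l^-1 - 1| by [].
rewrite powS// EFinM.
rewrite -muleA -DE -iposZl; [|exact: mD|by rewrite lee_fin powR_ge0
  |by move=> v _; rewrite lee_fin normr_ge0].
have mt1 : measurable_fun setT (fun v : measurableTypeR R => tent b (v * l)^-1).
  by apply: measurable_fun_tent; meas.
have mt2 : measurable_fun setT (fun v : measurableTypeR R => tent b v^-1).
  by apply: measurable_fun_tent; meas.
apply: le_ipos.
- by meas.
- by apply: emeasurable_funM; [meas|exact: mD].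
- by move=> v _; rewrite lee_fin mulr_ge0// powR_ge0.
move=> v v0; rewrite -EFinM lee_fin powS// mulrAC.
apply: ler_pM; rewrite ?mulr_ge0 ?powR_ge0//; last exact: tent_clamp.
rewrite -powRM ?(ltW v0)//; apply: ge0_ler_powR; rewrite ?nnegrE ?subr_ge0
    ?mulr_ge0 ?(ltW v0)//.
apply: le_trans (ler_wpM2r (ltW v0) (tent_lip _ _ _)) _.
have -> : `|(v * l)^-1 - v^-1| * v = `|((v * l)^-1 - v^-1) * v|.
  by rewrite normrM (gtr0_norm v0).
by rewrite mulrBl invfM mulrAC !mulVf ?gt_eqF// mul1r.
Qed.
End profile.

(** * Mass, energy and membership of the test functions *)

Section test_function.
Context (R : realType) (n : nat).
Local Notation mu := (@lebesgue_measure R).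
Local Notation S := (surface_measure (@unit_sphere R n.+1)).

(** The ground state is written as the inverse of v = |x|^gamma, the variable in which the masses
    are computed. *)
Definition test_fun (b gamma : R) (x : Rvec R n.+1) : R :=
  tent b (enorm x `^ gamma)^-1.

Lemma measurable_test_fun b gamma : measurable_fun setT (test_fun b gamma).
Proof.
have me : measurable_fun setT (@enorm R n.+1) by exact: measurable_enorm.
by apply: measurable_fun_tent; apply: measurable_fun_inv; exact: measurable_fun_powR.
Qed.

(** Under v = r^gamma the radial measure r^(a + n) dr becomes v^(P - 1) dv / |gamma| exactly when a
    + d = P gamma, the scale-invariance relation shared by the Hardy term and the right-hand
    side. *)
Lemma integral_test_fun (b gamma P a : R) : 1 <= b -> gamma != 0 ->
  a + n.+1%:R = P * gamma ->
  (\int[lebesgue_vec R n.+1]_x (`|test_fun b gamma x| `^ P * enorm x `^ a)%:E =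
   S * (`|gamma|^-1)%:E * tent_mass b P)%E.
Proof.
move=> b1 g0 Ea.
pose F r : \bar R := (`|tent b (r `^ gamma)^-1| `^ P * r `^ a)%:E.
have mt c : measurable_fun setT (fun r : measurableTypeR R => tent b (r `^ c)^-1).
  by apply: measurable_fun_tent; meas.
have mF : measurable_fun setT (F : measurableTypeR R -> \bar R).
  by have := mt gamma => h; rewrite /F; meas.
rewrite (@integral_enorm _ n F); [|exact: mF|by move=> r; rewrite lee_fin
    mulr_ge0// powR_ge0].
rewrite -[RHS]muleA; congr (_ * _)%E.
pose f v : \bar R := (tent b v^-1 `^ P * v `^ (P - 1))%:E.
have mf : measurable_fun setT (f : measurableTypeR R -> \bar R).
  have h : measurable_fun setT (fun v : measurableTypeR R => tent b v^-1).
    by apply: measurable_fun_tent; meas.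
  by rewrite /f; meas.
have f0 r : 0 < r -> (0 <= f r)%E by move=> _; rewrite lee_fin mulr_ge0// powR_ge0.
rewrite -[tent_mass b P]/(ipos f) -(ipos_pow g0 mf f0) -iposZl; last 3 first.
- apply: emeasurable_funM; last by meas.
  by apply: (measurableT_comp mf); meas.
- by rewrite lee_fin invr_ge0.
- by move=> r r0; rewrite mule_ge0 ?f0 ?powR_gt0// lee_fin mulr_ge0// powR_ge0.
apply: eq_ipos => r r0; rewrite /F /f -!EFinM ger0_norm ?tent_ge0//; congr EFin.
have gn : `|gamma| != 0 by rewrite normr_eq0.
have E (a1 a2 a3 a4 : R) : a4^-1 * (a1 * a2 * (a4 * a3)) = (a4^-1 * a4) * (a1 * (a2
    * a3)) by ring.
rewrite E mulVf// mul1r -mulrA; congr (_ * _).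
rewrite -powRrM -!gt0_powRD//; congr (_ `^ _).
rewrite (_ : gamma * (P - 1) = P * gamma - gamma); last by ring.
by rewrite -Ea -natr1; ring.
Qed.

(** For each t the inner integral of [gagliardo_radial] is bounded by [increment_mass_le] with l =
    t^gamma; what remains to integrate in t is the constant in the form of [hardy_constE]. *)
Lemma gagliardo_test_fun (s p alpha beta b : R) : 1 <= b -> 1 <= p ->
  let gamma := (n.+1%:R + alpha + beta - s * p) / p in gamma != 0 ->
  (gagliardo_pow s p alpha beta (test_fun b gamma) <=
   S * (`|gamma|^-1)%:E * clamp_mass b * hardy_const n.+1 s p alpha beta)%E.
Proof.
move=> b1 p1 gamma g0; have p0 : 0 < p by lra.
have gn : 0 < `|gamma| by rewrite normr_gt0.
pose U r := tent b (r `^ gamma)^-1.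
have mU : measurable_fun setT (U : measurableTypeR R -> R).
  by apply: measurable_fun_tent; meas.
rewrite (@gagliardo_radial R n s p alpha beta U p0 mU).
have k0 : (0 <= (`|gamma|^-1)%:E * clamp_mass b)%E.
  by rewrite mule_ge0 ?clamp_mass_ge0// lee_fin invr_ge0.
rewrite -[leRHS]muleA -[leRHS]muleA; apply: lee_pmul.
- by rewrite mule_ge0.
- apply: ipos_ge0 => t t0; case: ifP => // _; rewrite !mule_ge0 ?Phi_ge0//.
    by rewrite lee_fin mulr_ge0 ?addr_ge0 ?powR_ge0.
  by apply: ipos_ge0 => r r0; rewrite lee_fin mulr_ge0 ?powR_ge0.
- exact: lexx.
have mP : measurable_fun setT (fun t : measurableTypeR R => Phi n.+1 s p t) by
    exact: measurable_Phi.
have -> : ((`|gamma|^-1)%:E * (clamp_mass b * hardy_const n.+1 s p alpha beta))%E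
  = ipos (fun t => ((`|gamma|^-1)%:E * clamp_mass b) * (if (t < 1)%R then
    ((t `^ alpha + t `^ beta) * t `^ n%:R)%:E * Phi n.+1 s p t *
     (`|t `^ (- gamma) - 1| `^ p)%:E else 0))%E.
  rewrite muleA hardy_constE ?gt_eqF// -/gamma iposZl//; first by meas.
  move=> t t0; case: ifP => // _; rewrite !mule_ge0 ?Phi_ge0//.
  by rewrite lee_fin mulr_ge0 ?addr_ge0 ?powR_ge0.
apply: le_ipos.
- apply: measurable_fun_ifT; [by meas| |by meas].
  apply: emeasurable_funM; first by meas.
  have mG : measurable_fun setT (fun z : measurableTypeR R * measurableTypeR R =>
     (`|U (z.2 * z.1) - U z.2| `^ p * z.2 `^ (n.+1%:R + alpha + beta - s * p - 1))%:E).
    have h1 : measurable_fun setT (fun z : measurableTypeR R * measurableTypeR R =>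
        U (z.2 * z.1)).
      by apply: (measurableT_comp mU); meas.
    have h2 : measurable_fun setT (fun z : measurableTypeR R * measurableTypeR R =>
        U z.2).
      by apply: (measurableT_comp mU); meas.
    by meas.
  apply: (@measurable_tonelli1 _ _ _ _ _ mu (fun t r : measurableTypeR R => if 0 < r then
     (`|U (r * t) - U r| `^ p * r `^ (n.+1%:R + alpha + beta - s * p - 1))%:E else 0%E)).
    by apply: measurable_fun_ifT; [meas|exact: mG|meas].
  by move=> t r; case: ifP => // _; rewrite lee_fin mulr_ge0// powR_ge0.
- by apply: emeasurable_funM; [exact: measurable_cst|meas].
- move=> t t0; case: ifP => // _; rewrite !mule_ge0 ?Phi_ge0//.
    by rewrite lee_fin mulr_ge0 ?addr_ge0 ?powR_ge0.
  by apply: ipos_ge0 => r r0; rewrite lee_fin mulr_ge0 ?powR_ge0.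
move=> t t0; case: ifP => _; last by rewrite mule0.
rewrite [leRHS]muleCA; apply: lee_pmul => //.
- by rewrite mule_ge0 ?Phi_ge0// lee_fin mulr_ge0 ?addr_ge0 ?powR_ge0.
- by apply: ipos_ge0 => r r0; rewrite lee_fin mulr_ge0 ?powR_ge0.
have l0 : 0 < t `^ gamma by rewrite powR_gt0.
pose f v : \bar R := (`|tent b (v * t `^ gamma)^-1 - tent b v^-1| `^ p * v `^ (p - 1))%:E.
have mf : measurable_fun setT (f : measurableTypeR R -> \bar R).
  have h1 : measurable_fun setT (fun v : measurableTypeR R => tent b (v * t `^ gamma)^-1).
    by apply: measurable_fun_tent; meas.
  have h2 : measurable_fun setT (fun v : measurableTypeR R => tent b v^-1).
    by apply: measurable_fun_tent; meas.
  by rewrite /f; meas.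
have f0 r : 0 < r -> (0 <= f r)%E by move=> _; rewrite lee_fin mulr_ge0// powR_ge0.
have -> : ipos (fun r => (`|U (r * t)%R - U r| `^ p *
     r `^ (n.+1%:R + alpha + beta - s * p - 1))%:E) = ((`|gamma|^-1)%:E * ipos f)%E.
  rewrite -(ipos_pow g0 mf f0) -iposZl; last 3 first.
  - apply: emeasurable_funM; last by meas.
    by apply: (measurableT_comp mf); meas.
  - by rewrite lee_fin invr_ge0.
  - by move=> r r0; rewrite mule_ge0 ?f0 ?powR_gt0// lee_fin mulr_ge0// powR_ge0.
  apply: eq_ipos => r r0; rewrite /f /U powRM ?(ltW r0) ?(ltW t0)// -!EFinM.
  congr EFin.
  have E (a1 a2 a3 a4 : R) : a4^-1 * (a1 * a2 * (a4 * a3)) = (a4^-1 * a4) * (a1 *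
      (a2 * a3)) by ring.
  rewrite E mulVf ?gt_eqF// mul1r; congr (_ * _).
  rewrite -powRrM -!gt0_powRD//; congr (_ `^ _).
  rewrite (_ : gamma * (p - 1) + (gamma - 1) = gamma * p - 1); last by ring.
  by rewrite /gamma divfK// gt_eqF.
rewrite -muleA; apply: lee_pmul => //; first by apply: ipos_ge0.
rewrite muleC powRN; exact: increment_mass_le.
Qed.

End test_function.

Section test_function_sobolev.
Context (R : realType) (n : nat).
Local Notation S := (surface_measure (@unit_sphere R n.+1)).

Lemma sphere_fin_num : S \is a fin_num.
Proof. by rewrite ge0_fin_numE ?sphere_lt_pinfty// ltW// sphere_gt0. Qed.

Lemma clamp_mass_fin_num (b : R) : 1 <= b -> clamp_mass b \is a fin_num.
Proof. by move=> b1; rewrite ge0_fin_numE ?clamp_mass_lt_pinfty// clamp_mass_ge0. Qed.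

Lemma tent_mass_fin_num (b P : R) : 1 <= b -> 1 <= P -> tent_mass b P \is a fin_num.
Proof.
move=> b1 P1; rewrite ge0_fin_numE ?tent_mass_ge0//.
exact: le_lt_trans (tent_mass_le b1 P1) (clamp_mass_lt_pinfty b1).
Qed.

(** Membership in the space involves the weight |x|^(alpha + beta), the masses have an extra |x|^(-
    s p). On the support 1 <= w <= 2 b - 1, so |x|^sp = w^(- sp / gamma) is bounded for either sign
    of gamma. *)
Lemma test_fun_weight_le (b gamma p a sp : R) (x : Rvec R n.+1) :
  1 <= b -> 0 < p -> gamma != 0 ->
  `|test_fun b gamma x| `^ p * enorm x `^ (a + sp) <=
  (2 * b - 1) `^ `|sp / gamma| * (`|test_fun b gamma x| `^ p * enorm x `^ a).
Proof.
move=> b1 p0 g0.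
have [->|u0] := eqVneq (test_fun b gamma x) 0.
  by rewrite normr0 powR0 ?gt_eqF// !mul0r mulr0.
have /andP[w1 wB] := tent_supp b1 u0.
have r0 : 0 < enorm x.
  rewrite lt_def enorm_ge0 andbT; apply: contraTneq w1 => ->.
  by rewrite powR0// invr0 -ltNge.
rewrite gt0_powRD// mulrA mulrC ler_wpM2r ?mulr_ge0 ?powR_ge0//.
have -> : enorm x `^ sp = (enorm x `^ gamma)^-1 `^ (- (sp / gamma)).
  rewrite -powRN -powRrM; congr (_ `^ _); field; exact: g0.
set w := _^-1 in w1 wB *.
apply: (@le_trans _ _ (w `^ `|sp / gamma|)).
  by rewrite ler_powR// -normrN ler_norm.
by apply: ge0_ler_powR; rewrite ?nnegrE ?normr_ge0//; lra.
Qed.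

Lemma test_fun_sobolev (s p alpha beta b : R) : 1 <= b -> 1 <= p -> 0 < s < 1 ->
  - n.+1%:R < alpha < s * p -> - n.+1%:R < beta < s * p ->
  let gamma := (n.+1%:R + alpha + beta - s * p) / p in gamma != 0 ->
  weighted_sobolev s p alpha beta (@test_fun R n b gamma).
Proof.
move=> b1 p1 s01 hal hbe gamma g0; have p0 : 0 < p by lra.
have mu := @measurable_test_fun R n b gamma.
have me : measurable_fun setT (@enorm R n.+1) by exact: measurable_enorm.
have k0 : (0 <= S * (`|gamma|^-1)%:E)%E.
  by rewrite mule_ge0 ?lee_fin ?invr_ge0// ltW// sphere_gt0.
split => //.
- pose a := alpha + beta - s * p.
  have Ea : a + n.+1%:R = p * gamma by rewrite /gamma mulrC divfK ?gt_eqF// /a; ring.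
  pose M := (2 * b - 1) `^ `|s * p / gamma|.
  apply: (@le_lt_trans _ _ (\int[lebesgue_vec R n.+1]_x
      (M%:E * (`|test_fun b gamma x| `^ p * enorm x `^ a)%:E))%E).
    apply: ge0_le_integral => //.
    + by move=> x _; rewrite lee_fin mulr_ge0 ?powR_ge0.
    + by meas.
    + by meas.
    + move=> x _; rewrite -EFinM lee_fin.
      by have := test_fun_weight_le a (s * p) x b1 p0 g0; rewrite subrK.
  rewrite ge0_integralZl//; last 3 first.
  + by meas.
  + by move=> x _; rewrite lee_fin mulr_ge0 ?powR_ge0.
  + by rewrite lee_fin powR_ge0.
  rewrite (integral_test_fun b1 g0 Ea) -ge0_fin_numE; last first.
    by rewrite mule_ge0 ?lee_fin ?powR_ge0// mule_ge0 ?tent_mass_ge0.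
  apply: fin_numM => //; apply: fin_numM; last exact: tent_mass_fin_num.
  by apply: fin_numM => //; exact: sphere_fin_num.
- apply: le_lt_trans (gagliardo_test_fun b1 p1 g0) _.
  rewrite -ge0_fin_numE; last by rewrite !mule_ge0// ?clamp_mass_ge0// hardy_const_ge0.
  apply: fin_numM; last first.
    by rewrite ge0_fin_numE ?hardy_const_ge0// hardy_const_lt_pinfty.
  apply: fin_numM; last exact: clamp_mass_fin_num.
  by apply: fin_numM => //; exact: sphere_fin_num.
Qed.

End test_function_sobolev.

(** * Contradiction for large b *)

Theorem theorem4p2 (R : realType) (d : nat) (s p alpha beta : R)
    (hd : (1 <= d)%N) (hp : 1 <= p) (hs : 0 < s < 1)
    (halpha : - d%:R < alpha < s * p)
    (hbeta : - d%:R < beta < s * p)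
    (halphabeta : - d%:R < alpha + beta < s * p)
    (hne : s * p - alpha - beta != d%:R)
    (hspd : s * p < d%:R) :
  let q := d%:R * p / (d%:R - s * p) in
  ~ exists C0 : R, 0 < C0 /\
      forall u : Rvec R d -> R, weighted_sobolev s p alpha beta u ->
        (gagliardo_pow s p alpha beta u
         - hardy_const d s p alpha beta *
           (\int[lebesgue_vec R d]_x
              (`|u x| `^ p / enorm x `^ (s * p - alpha - beta))%:E)
         >= C0%:E *
            (\int[lebesgue_vec R d]_x
               (`|u x| `^ q * enorm x `^ (q / p * (alpha + beta)))%:E)
              `^ (p / q))%E.
Proof.
move=> q [C0 [C0_gt0 H]].
case: d => [//|n] in hd halpha hbeta halphabeta hne hspd q H *.
pose gamma := (n.+1%:R + alpha + beta - s * p) / p.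
have p0 : 0 < p by lra.
have g0 : gamma != 0.
  apply: mulf_neq0; last by rewrite invr_eq0 gt_eqF.
  apply: contra hne => /eqP h.
  by apply/eqP; lra.
have dsp0 : 0 < n.+1%:R - s * p by rewrite subr_gt0.
have sp0 : 0 < s * p by case/andP: hs => s0 _; rewrite mulr_gt0.
have q1 : 1 <= q.
  rewrite /q ler_pdivlMr// mul1r; have : n.+1%:R * 1 <= n.+1%:R * p :> R by rewrite
      ler_wpM2l.
  lra.
have q0 : 0 < q by lra.
have Ep : - (s * p - alpha - beta) + n.+1%:R = p * gamma.
  by rewrite /gamma [RHS]mulrC divfK ?gt_eqF//; ring.
(* The value of q enters here: it makes the right-hand integral invariant under the same scaling as
   the Hardy term. *)
have Eq : q / p * (alpha + beta) + n.+1%:R = q * gamma.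
  by rewrite /q /gamma; field; rewrite nat1r (gt_eqF p0) (gt_eqF dsp0).
pose S := surface_measure (@unit_sphere R n.+1).
have Sf : S \is a fin_num by exact: sphere_fin_num.
have Cf : hardy_const n.+1 s p alpha beta \is a fin_num.
  by rewrite ge0_fin_numE ?hardy_const_ge0// hardy_const_lt_pinfty.
pose k := fine S / `|gamma|; pose c := fine (hardy_const n.+1 s p alpha beta).
have SE : (S * (`|gamma|^-1)%:E)%E = k%:E by rewrite EFinM fineK.
have cE : hardy_const n.+1 s p alpha beta = c%:E by rewrite fineK.
have k0 : 0 < k by rewrite divr_gt0 ?normr_gt0// fine_gt0// sphere_gt0 sphere_lt_pinfty.
have c0 : 0 <= c by rewrite fine_ge0 ?hardy_const_ge0.
(* The left-hand side will be at most k c (A - h) <= k c (p + 2) = C0 K, independently of b. *)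
pose K := k * c * (p + 2) / C0.
have kc0 : 0 <= k * c by rewrite mulr_ge0// ltW.
have K0 : 0 <= K.
  by apply: divr_ge0 (ltW C0_gt0); apply: mulr_ge0 => //; lra.
(* Chosen so that (k L)^(p / q) = K + 1: a mass N >= L makes the right-hand side at least C0 (K +
   1). *)
pose L := (K + 1) `^ (q / p) / k.
have L0 : 0 <= L by rewrite divr_ge0 ?powR_ge0// ltW.
(* Then A >= ln b - 1 = L + q + 2, and the loss of at most q + 2 in passing from A to N leaves N >=
   L. *)
pose b := expR (L + q + 3).
have b1 : 1 < b by rewrite expR_gt1; lra.
have b1' := ltW b1.
have := H _ (test_fun_sobolev b1' hp hs halpha hbeta g0).
rewrite -/gamma.
have -> : (\int[lebesgue_vec R n.+1]_x
    (`|test_fun b gamma x| `^ p / enorm x `^ (s * p - alpha - beta))%:E =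
  \int[lebesgue_vec R n.+1]_x
    (`|test_fun b gamma x| `^ p * enorm x `^ (- (s * p - alpha - beta)))%:E)%E.
  by apply: eq_integral => x _; rewrite powRN.
rewrite (integral_test_fun b1' g0 Ep) (integral_test_fun b1' g0 Eq).
rewrite -/S SE cE.
have [A AE] : exists A, clamp_mass b = A%:E.
  by exists (fine (clamp_mass b)); rewrite fineK// clamp_mass_fin_num.
have [h hE] : exists h, tent_mass b p = h%:E.
  by exists (fine (tent_mass b p)); rewrite fineK// tent_mass_fin_num.
have [N NE] : exists N, tent_mass b q = N%:E.
  by exists (fine (tent_mass b q)); rewrite fineK// tent_mass_fin_num.
have Ah := clamp_mass_le b1' hp; have AN := clamp_mass_le b1' q1.
have Ab := clamp_mass_ge b1.
have EA := gagliardo_test_fun b1' hp g0 (n := n) (s := s) (alpha := alpha) (beta := beta).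
rewrite -/S -/gamma SE cE AE -!EFinM in EA.
rewrite AE hE -EFinD lee_fin in Ah; rewrite AE NE -EFinD lee_fin in AN.
rewrite AE lee_fin expRK in Ab.
rewrite hE NE -!EFinM => /le_trans /(_ (leeB EA (lexx _))).
rewrite -EFinB lee_fin => fin.
have LN : L <= N by lra.
have pq0 : 0 < p / q by rewrite divr_gt0.
have : K + 1 <= (k * N) `^ (p / q).
  have -> : K + 1 = ((K + 1) `^ (q / p)) `^ (p / q).
    rewrite -powRrM (_ : q / p * (p / q) = 1) ?powRr1//; first lra.
    by field; rewrite (gt_eqF p0) (gt_eqF q0).
  apply: ge0_ler_powR; rewrite ?nnegrE ?(ltW pq0) ?powR_ge0//.
    by rewrite mulr_ge0 ?(ltW k0)//; lra.
  by rewrite [leRHS]mulrC -ler_pdivrMr.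
move=> /(ler_wpM2l (ltW C0_gt0)) h1.
have : k * A * c - c * (k * h) <= C0 * K.
  rewrite /K [leRHS]mulrC divfK ?gt_eqF// (_ : k * A * c - c * (k * h) = k * c * (A
      - h)); last by ring.
  by apply: ler_wpM2l => //; lra.
lra.
Qed.
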